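(* Let $A$ be a finite nonempty alphabet and let $\mu:A^*\to\mathbb Q^{n\times n}$ be the homomorphism corresponding to a complete and transitive unambiguous automaton with vertices $1,\dots,n$. Let $M=\sum_{a\in A}a\,\mu a$ be its matrix, and let $P$ be the image of $M$ in $\mathcal P^{n\times n}$, where $\mathcal P$ is the probabilistic free field. For each vertex $i$, let $C_i$ be the code which is the basis of the free submonoid $\{w\in A^*: (\mu w)_{ii}=1\}$, and let $P_i$ be the sum of the labels of all paths starting at $i$ and not passing again through $i$. Let $\lambda$ be the unique derivation of the free field $\mathcal F$ of $\mathbb Q\langle A\rangle$ with $\lambda(a)=a$ for all $a\in A$. Then $P_i$, $C_i$ and $P_i^{-1}$ can be evaluated in $\mathcal P$ for every $i$. Moreover, the following hold in $\mathcal P$: (i) $C_i=1$ for every $i$; (ii) for a central variable $t$, the matrix $(1-t)(tP)^*$ over $\mathcal P(t)$ can be evaluated at $t=1$, and the diagonal elements of its value are $\lambda(C_i)^{-1}$, $i=1,\dots,n$; (iii) $(P_1^{-1},\dots,P_n^{-1})\,P=(P_1^{-1},\dots,P_n^{-1})$; (iv) $\sum_{i=1}^nP_i^{-1}=1$; (v) for any maximal columns $\ell,\ell'$, one has $(P_1^{-1},\dots,P_n^{-1})\,\ell=(P_1^{-1},\dots,P_n^{-1})\,\ell'$.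
   Context: Unambiguous automata: an unambiguous automaton over $A$ with vertices $1,\dots,n$ is a monoid homomorphism $\mu:A^*\to\mathbb Q^{n\times n}$ such that every matrix $\mu w$, $w\in A^*$, has entries in $\{0,1\}$. Its labelled directed graph has an edge $i\xrightarrow{a}j$ iff $(\mu a)_{ij}=1$; the label of a path is the product of its edge labels. The automaton is complete if the zero matrix is not in $\mu A^*$, and transitive if the graph is strongly connected (for all $i,j$ there is $w$ with $(\mu w)_{ij}\ne0$). Columns (0-1 vectors) are ordered by inclusion of the corresponding subsets of $\{1,\dots,n\}$. A maximal column is a column which is maximal among all columns of all elements of $\mu A^*$. A code is the basis of a free submonoid of $A^*$. A language is identified with the sum of its words in $\mathbb Q\langle\langle A\rangle\rangle$. The series $P_i$ includes the empty path; a word occurs in $P_i$ once for each such path having it as label. $C_i$ and $P_i$ are rational series. Free field: for a set $X$ of noncommuting variables, the free field is the (unique up to isomorphism) skew field $\mathcal F\supseteq\mathbb Q\langle X\rangle$, generated as a skew field by $\mathbb Q\langle X\rangle$, such that for each $\mathbb Q$-algebra homomorphism $\mu:\mathbb Q\langle X\rangle\to D$ into a skew field $D$ there are a subalgebra $O_\mu$ with $\mathbb Q\langle X\rangle\subseteq O_\mu\subseteq\mathcal F$ and a homomorphism $\overline\mu:O_\mu\to D$ extending $\mu$ such that $f\in O_\mu$, $\overline\mu(f)\ne0$ imply $f^{-1}\in O_\mu$. The quotient $\mathbb Q\langle A\rangle/(\sum_{a\in A}a-1)$ is a free associative algebra (eliminate one letter); its free field is the probabilistic free field $\mathcal P$.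 Evaluation in $\mathcal P$: a series in $\mathbb Q\langle\langle A\rangle\rangle$ is rational if it has a $*$-rational expression, i.e. a well-formed expression in scalars, letters, sums, products and the star $T\mapsto T^*=\sum_{m\ge0}T^m=(1-T)^{-1}$ applied to series $T$ with zero constant term. Replacing $T^*$ by $(1-T)^{-1}$ gives a canonical embedding of the ring of rational series into $\mathcal F$. An element of $\mathcal F$ can be evaluated in $\mathcal P$ if it is given by a rational expression (sums, products, inverses) over $\mathbb Q\langle A\rangle$ which can be computed in $\mathcal P$ without ever inverting $0$. Its value does not depend on the choice of such an expression. Evaluation at $t=1$: for a skew field $D$ and a central variable $t$, $D(t)$ is the skew field of fractions of the Ore domain $D[t]$. A nonzero $f\in D(t)$ can be written $f=(1-t)^mQR^{-1}$ with $m\in\mathbb Z$, $Q,R\in D[t]$, $Q(1),R(1)\neq0$. It can be evaluated at $t=1$ if $m\ge0$, with value $Q(1)R(1)^{-1}$ if $m=0$ and $0$ if $m\ge1$; also $0$ has value $0$. A matrix over $D(t)$ can be evaluated at $t=1$ if all its entries can. For a square matrix $N$ over $D$, $(tN)^*=(1-tN)^{-1}$, which exists over $D(t)$. *)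

(* Defs.v *)
From HB Require Import structures.
From mathcomp Require Import all_boot all_order all_algebra.
From mathcomp Require Import boolp classical_sets.
From mathcomp Require Import finmap monalg.

Set Implicit Arguments.
Unset Strict Implicit.
Unset Printing Implicit Defensive.

Import GRing.Theory.

Local Open Scope ring_scope.

(* Q<A>.  The alias carries the (two-sided) algebra structure, which the library
   only provides for monoid algebras of commutative monoids. *)
Definition ncpoly (A : choiceType) : Type := {malg rat[{fmonom A}]}.

HB.instance Definition _ (A : choiceType) :=
  GRing.Lalgebra.copy (ncpoly A) {malg rat[{fmonom A}]}.

Lemma ncpoly_scalerAr (A : choiceType) (c : rat) (x y : ncpoly A) :
  c *: (x * y) = x * (c *: y).
Proof.
apply/malgP => k; rewrite (mcoeffZ c (x * y : {malg _[_]})) mcoeffMl.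
rewrite (mcoeffMlw k (fsubset_refl _) (msuppZ_le c y)) mulr_sumr.
apply: eq_bigr => k1 _; rewrite mulr_sumr; apply: eq_bigr => k2 _.
by rewrite mcoeffZ mulrnAr mulrCA.
Qed.

HB.instance Definition _ (A : choiceType) :=
  GRing.Lalgebra_isAlgebra.Build rat (ncpoly A) (@ncpoly_scalerAr A).

Definition letter (A : choiceType) (a : A) : ncpoly A := << fmu a >>.

Definition skew_field (D : unitRingType) : Prop :=
  forall x : D, x != 0 -> x \is a GRing.unit.

(* The homomorphism [mbar] is only constrained on the subalgebra [O]. *)
Definition specialization (B : algType rat) (F : unitAlgType rat)
    (iota : {lrmorphism B -> F}) (D : unitAlgType rat)
    (m : {lrmorphism B -> D}) (O : {pred F}) (mbar : F -> D) : Prop :=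
  [/\ subalg_closed O /\ (forall p, iota p \in O),
      mbar 1 = 1 /\ {in O &, {morph mbar : x y / x * y}},
      forall c : rat, {in O &, forall x y, mbar (c *: x + y) = c *: mbar x + mbar y},
      forall p, mbar (iota p) = m p
    & {in O, forall f, mbar f != 0 -> f^-1 \in O}].

(* [B] is meant to be a free associative algebra, not necessarily presented as
   some [ncpoly X]. *)
Definition is_free_field (B : algType rat) (F : unitAlgType rat)
    (iota : {lrmorphism B -> F}) : Prop :=
  [/\ skew_field F,
      injective iota,
      forall S : {pred F}, divring_closed S -> (forall p, iota p \in S) ->
        forall f, f \in S
    & forall (D : unitAlgType rat) (m : {lrmorphism B -> D}), skew_field D ->
        exists (O : {pred F}) (mbar : F -> D), specialization iota m O mbar].

Definition in_ideal (E : algType rat) (r x : E) : Prop :=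
  exists s : seq (E * E), x = \sum_(uv <- s) uv.1 * r * uv.2.

Definition is_quotient (E B : algType rat) (r : E) (q : {lrmorphism E -> B}) : Prop :=
  (forall b, exists p, q p = b) /\ (forall p, q p = 0 <-> in_ideal r p).

Inductive rexp (A : choiceType) : Type :=
| RPoly of ncpoly A
| RAdd of rexp A & rexp A
| RMul of rexp A & rexp A
| RInv of rexp A.

(* [None] when the computation inverts 0. *)
Fixpoint rval (A : choiceType) (D : unitRingType) (phi : ncpoly A -> D)
    (e : rexp A) : option D :=
  match e with
  | RPoly p => Some (phi p)
  | RAdd e1 e2 =>
      if rval phi e1 is Some x then
        if rval phi e2 is Some y then Some (x + y) else None
      else None
  | RMul e1 e2 =>
      if rval phi e1 is Some x then
        if rval phi e2 is Some y then Some (x * y) else None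
      else None
  | RInv e1 =>
      if rval phi e1 is Some x then
        if x == 0 then None else Some x^-1
      else None
  end.

(* [f] in the skew field [F] (via [iota]) can be evaluated in [D] (via [phi]),
   with value [v]. *)
Definition evaluates (A : choiceType) (F D : unitRingType) (iota : ncpoly A -> F)
    (phi : ncpoly A -> D) (f : F) (v : D) : Prop :=
  exists e : rexp A, rval iota e = Some f /\ rval phi e = Some v.

(* Q<<A>> *)
Definition series (A : choiceType) : Type := seq A -> rat.

Definition series1 (A : choiceType) : series A := fun w => (w == [::])%:R.

Definition series_mul (A : choiceType) (S T : series A) : series A :=
  fun w => \sum_(k < (size w).+1) S (take k w) * T (drop k w).

Definition series_exp (A : choiceType) (S : series A) (m : nat) : series A :=
  iter m (series_mul S) (@series1 A).

(* If S has zero constant term, then S^m vanishes on words of length < m, so that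
   the sum over all m reduces to m <= |w|. *)
Definition series_star (A : choiceType) (S : series A) : series A :=
  fun w => \sum_(m < (size w).+1) series_exp S m w.

Inductive sexp (A : choiceType) : Type :=
| SScalar of rat
| SLetter of A
| SAdd of sexp A & sexp A
| SMul of sexp A & sexp A
| SStar of sexp A.

Fixpoint sexp_series (A : choiceType) (e : sexp A) : series A :=
  match e with
  | SScalar c => fun w => c * (w == [::])%:R
  | SLetter a => fun w => (w == [:: a])%:R
  | SAdd e1 e2 => fun w => sexp_series e1 w + sexp_series e2 w
  | SMul e1 e2 => series_mul (sexp_series e1) (sexp_series e2)
  | SStar e1 => series_star (sexp_series e1)
  end.

Fixpoint sexp_wf (A : choiceType) (e : sexp A) : bool :=
  match e with
  | SScalar _ | SLetter _ => true
  | SAdd e1 e2 | SMul e1 e2 => sexp_wf e1 && sexp_wf e2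
  | SStar e1 => sexp_wf e1 && (sexp_series e1 [::] == 0)
  end.

Fixpoint rexp_of_sexp (A : choiceType) (e : sexp A) : rexp A :=
  match e with
  | SScalar c => RPoly c%:A
  | SLetter a => RPoly (letter a)
  | SAdd e1 e2 => RAdd (rexp_of_sexp e1) (rexp_of_sexp e2)
  | SMul e1 e2 => RMul (rexp_of_sexp e1) (rexp_of_sexp e2)
  | SStar e1 => RInv (RAdd (RPoly 1) (RMul (RPoly (- 1)) (rexp_of_sexp e1)))
  end.

(* The image of a rational series under the canonical embedding into the free
   field: the value of any *-rational expression of the series, with T^* read as
   (1 - T)^-1. *)
Definition series_embed (A : choiceType) (F : unitRingType) (iota : ncpoly A -> F)
    (S : series A) : F :=
  xget 0 [set f | exists e : sexp A,
    [/\ sexp_wf e, sexp_series e =1 S & rval iota (rexp_of_sexp e) = Some f]].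

Definition lang_series (A : choiceType) (L : pred (seq A)) : series A :=
  fun w => (L w)%:R.

Section Automata.
Variables (A : finType) (n : nat).
Implicit Type mu : seq A -> 'M[rat]_n.

Definition unambiguous_automaton mu : Prop :=
  [/\ mu [::] = 1%:M,
      forall u v, mu (u ++ v) = mu u *m mu v
    & forall w i j, mu w i j \in [:: 0; 1]].

Definition complete_automaton mu : Prop := forall w, mu w != 0.

Definition transitive_automaton mu : Prop :=
  forall i j, exists w, mu w i j != 0.

Definition automaton_mx mu : 'M[ncpoly A]_n :=
  \matrix_(i, j) \sum_(a : A) mu [:: a] i j *: letter a.

(* [vs] lists the successive vertices, after the initial vertex [i], of a path
   labelled [w]. *)
Fixpoint is_path mu (i : 'I_n) (w : seq A) (vs : seq 'I_n) : bool :=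
  match w, vs with
  | [::], [::] => true
  | a :: w', j :: vs' => (mu [:: a] i j == 1) && is_path mu j w' vs'
  | _, _ => false
  end.

Definition path_series mu (i : 'I_n) : series A :=
  fun w => #|[set vs : (size w).-tuple 'I_n | is_path mu i w vs && (i \notin vs)]|%:R.

Definition is_column mu (l : 'cV[rat]_n) : Prop :=
  exists w j, l = col j (mu w).

Definition col_set (l : 'cV[rat]_n) : {set 'I_n} := [set i | l i 0 != 0].

Definition maximal_column mu (l : 'cV[rat]_n) : Prop :=
  is_column mu l /\
  forall l', is_column mu l' -> col_set l \subset col_set l' -> l' = l.

End Automata.

Definition is_basis (A : finType) (N C : pred (seq A)) : Prop :=
  (forall w, N w <-> exists2 s : seq (seq A), all C s & w = flatten s) /\
  (forall s s' : seq (seq A), all C s -> all C s' -> flatten s = flatten s' -> s = s').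

Definition is_derivation (F : nzRingType) (d : F -> F) : Prop :=
  (forall x y, d (x + y) = d x + d y) /\ (forall x y, d (x * y) = d x * y + x * d y).

(* [K] is the skew field of fractions D(t) of D[t], with t = 'X. *)
Definition is_fraction_field (D K : unitRingType) (j : {rmorphism {poly D} -> K}) :
    Prop :=
  [/\ skew_field K,
      injective j
    & forall f : K, exists Q R : {poly D}, R != 0 /\ f = j Q / j R].

Definition eval_at1 (D K : unitRingType) (j : {rmorphism {poly D} -> K})
    (f : K) (v : D) : Prop :=
  (f = 0 /\ v = 0) \/
  exists (m : nat) (Q R : {poly D}),
    [/\ Q.[1] != 0, R.[1] != 0, f = j (1 - 'X) ^+ m * j Q / j R
      & v = if m == 0%N then Q.[1] / R.[1] else 0].

(* [S] is (tN)^*, the two-sided inverse of 1 - tN over D(t). *)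
Definition is_star_mx (D K : unitRingType) (j : {rmorphism {poly D} -> K}) (n : nat)
    (N : 'M[D]_n) (S : 'M[K]_n) : Prop :=
  let T := 1%:M - j 'X *: map_mx (j \o polyC) N in
  T *m S = 1%:M /\ S *m T = 1%:M.

(* Main.v *)
(* Let M be the matrix of the automaton and E_i the diagonal matrix of 1's with a 0 at i.
   With X_i = (1 - M E_i)^-1 one has P_i = sum_k (X_i)_ik and C_i = (X_i M)_ii.

   A rational expression can be evaluated in the probabilistic free field as soon as it
   can be evaluated in Q at the letters a = 1/|A|, by the universal property; and a matrix
   of evaluable elements is invertible, with evaluable inverse, as soon as its value over Q
   is. So all invertibility questions concern nonnegative rational matrices, where they
   follow from a minimum principle once M has a positive fixed column y.

   That column is found as y = L u, where L consists of the maximal columns. The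
   letters map maximal columns to maximal columns, and words act transitively on them, so
   M L = L Q where Q has column sums 1 in the probabilistic free field; such a Q has a fixed
   column u, and its fixed rows are the constant ones, which also gives (v).

   From M y = y one gets C_i = 1, hence the i-th row of X_i is a fixed row of M with i-th
   entry 1 and sum P_i; fixed rows being unique up to a left factor, (P_1^-1, ..., P_n^-1) is
   the normalized one, called pi. Finally (1-t)(tM)^* tends to J = y (pi y)^-1 pi, and
   lambda(C_i) = (X_i X_i M)_ii = P_i (pi y) y_i^-1. *)

Require Import Defs.
From HB Require Import structures.
From mathcomp Require Import all_boot all_order all_algebra.
From mathcomp Require Import boolp classical_sets.
From mathcomp Require Import monalg.
Import Order.TTheory GRing.Theory Num.Theory.
Local Open Scope ring_scope.

Set Implicit Arguments.
Unset Strict Implicit.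
Unset Printing Implicit Defensive.

(** * Inverting matrices over a local subring *)

(** A skew field has neither determinants nor an order, so matrices over [PF] cannot be inverted by
    a direct criterion. Block elimination ([lift_inverse]) inverts every matrix that becomes the
    identity under a ring morphism, provided the elements with image 1 are invertible. It serves
    three subrings: fractions regular at t = 1, paired with their value; rational series, paired
    with their element of [F] and mapped to their constant term; and triples of values of one
    rational expression in [F], [PF] and Q. The triples keep the three computations synchronized, so
    that an identity in [PF] concerns the very expression that gives C_i or P_i in [F]. A separate
    obstacle is that [series_embed] chooses an expression of the series; independence of this choice
    is obtained from finite linear representations shared by the series and the element of [F]. *)

Section Lifting.
Variables (T D : nzRingType) (E : T -> Prop) (rho : {rmorphism T -> D}).
Hypothesis E1 : E 1.
Hypothesis EN : forall x, E x -> E (- x).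
Hypothesis ED : forall x y, E x -> E y -> E (x + y).
Hypothesis EM : forall x y, E x -> E y -> E (x * y).
Hypothesis EV : forall x, E x -> rho x = 1 -> exists y, [/\ E y, x * y = 1 & y * x = 1].

Definition mx_in m n (N : 'M[T]_(m, n)) := forall i j, E (N i j).

Lemma closed0 : E 0.
Proof. by rewrite -(subrr 1); apply: ED => //; apply: EN. Qed.

Lemma mx_in_add m n (N N' : 'M[T]_(m, n)) : mx_in N -> mx_in N' -> mx_in (N + N').
Proof. by move=> h h' i j; rewrite mxE; apply: ED. Qed.

Lemma mx_in_opp m n (N : 'M[T]_(m, n)) : mx_in N -> mx_in (- N).
Proof. by move=> h i j; rewrite mxE; apply: EN. Qed.

Lemma closed_sum I (r : seq I) (P : pred I) (f : I -> T) :
  (forall i, P i -> E (f i)) -> E (\sum_(i <- r | P i) f i).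
Proof. by move=> h; apply: big_ind => //; exact: closed0. Qed.

Lemma mx_in_mul m n p (N : 'M[T]_(m, n)) (N' : 'M[T]_(n, p)) :
  mx_in N -> mx_in N' -> mx_in (N *m N').
Proof. by move=> h h' i j; rewrite mxE; apply: closed_sum => k _; apply: EM. Qed.

Lemma mx_in1 n : mx_in (1%:M : 'M[T]_n).
Proof. by move=> i j; rewrite mxE; case: (i == j) => //=; exact: closed0. Qed.

(** The upper left entry lies over 1, hence is a pivot with inverse in [E]; its Schur complement
    again lies over the identity because [c] maps to 0. So only elements over 1 ever have to be
    inverted. *)
Lemma lift_inverse n (N : 'M[T]_n) : mx_in N -> map_mx rho N = 1%:M ->
  exists Y : 'M[T]_n, [/\ mx_in Y, N *m Y = 1%:M & Y *m N = 1%:M].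
Proof.
elim: n N => [|n IHn] N; first by move=> _ _; exists 0; split => [[]||] //;
  apply/matrixP => -[].
rewrite -[n.+1]/(1 + n)%N in N *.
rewrite -[N]submxK; set a := ulsubmx N; set b := ursubmx N; set c := dlsubmx N.
set d := drsubmx N => EN0 rN.
have Ea : mx_in a by move=> i j; have := EN0 (lshift n i) (lshift n j); rewrite block_mxEul.
have Eb : mx_in b by move=> i j; have := EN0 (lshift n i) (rshift 1 j); rewrite block_mxEur.
have Ec : mx_in c by move=> i j; have := EN0 (rshift 1 i) (lshift n j); rewrite block_mxEdl.
have Ed : mx_in d by move=> i j; have := EN0 (rshift 1 i) (rshift 1 j); rewrite block_mxEdr.
move: rN; rewrite map_block_mx scalar_mx_block => /eq_block_mx[ra rb rc rd].
have [v [Ev av va]]: exists v, [/\ E v, a 0 0 * v = 1 & v * a 0 0 = 1].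
  by apply: EV => //; have := congr1 (fun M : 'M_1 => M 0 0) ra; rewrite !mxE.
pose V : 'M[T]_1 := v%:M.
have EVm : mx_in V by move=> i j; rewrite mxE !ord1.
have aV : a *m V = 1%:M by rewrite [a]mx11_scalar -scalar_mxM av.
have Va : V *m a = 1%:M by rewrite [a]mx11_scalar -scalar_mxM va.
have [Y [EY sY Ys]]: exists Y : 'M[T]_n, [/\ mx_in Y, (d - c *m V *m b) *m Y = 1%:M
                                        & Y *m (d - c *m V *m b) = 1%:M].
  apply: IHn; first by apply: mx_in_add => //; apply/mx_in_opp/mx_in_mul/Eb/mx_in_mul.
  by rewrite map_mxD map_mxN !map_mxM rc !mul0mx subr0.
have dY : d *m Y = 1%:M + c *m V *m b *m Y by rewrite -sY mulmxBl addrNK.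
have Yd : Y *m d = 1%:M + Y *m c *m V *m b.
  by rewrite -Ys mulmxBr !mulmxA addrNK.
exists (block_mx (V + V *m b *m Y *m c *m V) (- (V *m b *m Y)) (- (Y *m c *m V)) Y).
split.
- move=> i j; rewrite -[i]splitK -[j]splitK.
  case: (split i) => i'; case: (split j) => j' /=;
    rewrite ?(block_mxEul, block_mxEur, block_mxEdl, block_mxEdr).
  + by apply: mx_in_add => //; do ! (apply: mx_in_mul => //).
  + by apply: mx_in_opp; do ! (apply: mx_in_mul => //).
  + by apply: mx_in_opp; do ! (apply: mx_in_mul => //).
  + exact: EY.
- rewrite mulmx_block [RHS](@scalar_mx_block _ 1 n); congr block_mx.
  + by rewrite mulmxDr !mulmxA aV mulmxN !mulmxA !mul1mx addrK.
  + by rewrite mulmxN !mulmxA aV mul1mx addNr.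
  + by rewrite mulmxN !mulmxA dY !mulmxDl mul1mx mulmxDr !mulmxA subrr.
  + by rewrite mulmxN !mulmxA dY addrC addrK.
- rewrite mulmx_block [RHS](@scalar_mx_block _ 1 n); congr block_mx.
  + by rewrite mulmxDl mulNmx -!mulmxA Va mulmx1 addrK.
  + rewrite mulNmx mulmxDl -!mulmxA Yd mulmxDr mulmx1 mulmxDr !mulmxA.
    by rewrite subrr.
  + by rewrite mulNmx -!mulmxA Va mulmx1 addNr.
  + by rewrite mulNmx Yd addrC -!mulmxA addrK.
Qed.
End Lifting.

(** [G] is an approximate inverse: both [N *m G] and [G *m N] lie over the identity, which gives a
    right and a left inverse of [N], necessarily equal. *)
Lemma lift_inverse_mod (T D : nzRingType) (E : T -> Prop) (rho : {rmorphism T -> D}) :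
  E 1 -> (forall x, E x -> E (- x)) -> (forall x y, E x -> E y -> E (x + y)) ->
  (forall x y, E x -> E y -> E (x * y)) ->
  (forall x, E x -> rho x = 1 -> exists y, [/\ E y, x * y = 1 & y * x = 1]) ->
  forall n (N G : 'M[T]_n), mx_in E N -> mx_in E G ->
  map_mx rho N *m map_mx rho G = 1%:M -> map_mx rho G *m map_mx rho N = 1%:M ->
  exists Y : 'M[T]_n, [/\ mx_in E Y, N *m Y = 1%:M & Y *m N = 1%:M].
Proof.
move=> E1 EN ED EM EV n N G hN hG NG GN.
have hNG := mx_in_mul E1 EN ED EM hN hG; have hGN := mx_in_mul E1 EN ED EM hG hN.
have [|Y [EY sY _]] := lift_inverse E1 EN ED EM EV hNG; first by rewrite map_mxM.
have [|Y' [EY' _ Ys]] := lift_inverse E1 EN ED EM EV hGN; first by rewrite map_mxM.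
have r : N *m (G *m Y) = 1%:M by rewrite mulmxA.
have l : (Y' *m G) *m N = 1%:M by rewrite -mulmxA.
exists (G *m Y); split=> //; first exact: mx_in_mul.
suff -> : G *m Y = Y' *m G by [].
by rewrite -[LHS]mul1mx -l -[LHS]mulmxA r mulmx1.
Qed.

(* [M *m omit i] is [M] with its [i]-th column replaced by 0: for the matrix of the
   automaton, arriving at vertex [i] is forbidden. *)
Definition omit (R : nzRingType) n (i : 'I_n) : 'M[R]_n := 1%:M - delta_mx i i.

Lemma omit_row (R : nzRingType) n (i : 'I_n) m (x : 'M[R]_(m, n)) :
  x *m omit R i = x - col i x *m delta_mx 0 i.
Proof.
rewrite /omit mulmxBr mulmx1; congr (_ - _); by rewrite colE -mulmxA mul_delta_mx.
Qed.

Lemma omit_mxE (R : nzRingType) n (i : 'I_n) m (x : 'M[R]_(m, n)) k l :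
  (x *m omit R i) k l = x k l * (l != i)%:R.
Proof.
rewrite omit_row !mxE big_ord1 !mxE eqxx /=; case: eqVneq => [->|_].
  by rewrite mulr1 mulr0 subrr.
by rewrite mulr0 subr0 mulr1.
Qed.

(** * A minimum principle for nonnegative matrices *)

Section Positivity.
Variables (R : realFieldType) (n : nat) (M : 'M[R]_n) (y : 'cV[R]_n) (i : 'I_n).
Hypothesis M_ge0 : forall k l, 0 <= M k l.
Hypothesis y_gt0 : forall k, 0 < y k 0.
Hypothesis My : M *m y = y.
Hypothesis reach : forall S : pred 'I_n, (exists k, S k) ->
  (forall k l, S k -> M k l != 0 -> S l) -> S i.

(** If the least ratio [c] of [z] to the positive fixed column [y] were negative, the equality z = c
    y would propagate from a minimizing vertex along all edges, and none of these edges could enter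
    [i]; but [reach] forces one to do so. *)
Lemma minimum_principle (z : 'cV[R]_n) :
  (forall k, 0 <= ((1%:M - M *m omit R i) *m z) k 0) -> forall k, 0 <= z k 0.
Proof.
move=> hz k.
have hzE k0 : \sum_(l | l != i) M k0 l * z l 0 <= z k0 0.
  have := hz k0; rewrite mulmxBl mul1mx !mxE subr_ge0; apply: le_trans.
  rewrite [leRHS](bigD1 i) //= omit_mxE eqxx mulr0 mul0r add0r.
  by apply: ler_sum => l li; rewrite omit_mxE li mulr1.
have yE k0 : y k0 0 = M k0 i * y i 0 + \sum_(l | l != i) M k0 l * y l 0.
  by rewrite -{1}My mxE (bigD1 i).
have [k0 _ kmin] : exists2 k0, true & forall l, z k0 0 / y k0 0 <= z l 0 / y l 0.
  by case: (arg_minP (fun l => z l 0 / y l 0) (erefl : xpredT k)) => k0 _ h;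
    exists k0 => // l; exact: h.
set c := z k0 0 / y k0 0 in kmin.
have zc l : c * y l 0 <= z l 0 by rewrite -ler_pdivlMr.
case: (lerP 0 c) => [c0|c_lt0].
  by apply: le_trans (zc k); rewrite mulr_ge0 // ltW.
pose S := [pred l | z l 0 == c * y l 0].
have Sk0 : S k0 by rewrite /= /c divfK // gt_eqF.
have stepS l : S l -> M l i = 0 /\ (forall l', l' != i -> M l l' != 0 -> S l').
  move=> /eqP Sl.
  have tot : (\sum_(l' | l' != i) M l l' * (z l' 0 - c * y l' 0)) - c * (M l i * y i 0) <= 0.
    have := hzE l; rewrite Sl yE mulrDr -subr_le0; apply: le_trans.
    rewrite opprD addrA addrAC lerD2r.
    rewrite mulr_sumr -sumrB; apply: ler_sum => l' _.
    by rewrite mulrBr (mulrCA c).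
  have nn l' : 0 <= M l l' * (z l' 0 - c * y l' 0) by rewrite mulr_ge0 ?subr_ge0.
  have nni : 0 <= - (c * (M l i * y i 0)).
    by rewrite -mulNr mulr_ge0 ?oppr_ge0 ?(ltW c_lt0) // mulr_ge0 // ltW.
  have sn : 0 <= \sum_(l' | l' != i) M l l' * (z l' 0 - c * y l' 0) by rewrite sumr_ge0.
  have s0 : \sum_(l' | l' != i) M l l' * (z l' 0 - c * y l' 0) = 0.
    by apply/eqP; rewrite eq_le sn andbT; apply: le_trans tot; rewrite lerDl.
  move: tot nni; rewrite s0 add0r => t1 t2.
  have /eqP : - (c * (M l i * y i 0)) = 0 by apply/eqP; rewrite eq_le t1 t2.
  rewrite oppr_eq0 mulf_eq0 (lt_eqF c_lt0) mulf_eq0 (gt_eqF (y_gt0 i)) orbF /= => /eqP ->;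
    split=> // l' li Ml.
  have /allP/(_ l') : all (fun l' => (l' != i) ==> (M l l' * (z l' 0 - c * y l' 0) == 0))
    (index_enum 'I_n).
    by rewrite -psumr_eq0 ?s0.
  by rewrite mem_index_enum li /= mulf_eq0 (negPf Ml) subr_eq0 => /(_ isT).
(* The set of successors of [S] is used, not [S]: [i] may belong to [S], and the contradiction is an
   edge from [S] into [i]. It is nonempty because [My] and positivity exclude a zero row. *)
pose S' := [pred l | [exists l0, S l0 && (M l0 l != 0)]].
have S'i : S' i.
  apply: reach.
    have : y k0 0 != 0 by rewrite gt_eqF.
    rewrite -My mxE => /eqP nz.
    case: (pickP (fun l => M k0 l != 0)) => [l Ml|all0].
      by exists l; apply/existsP; exists k0; rewrite Sk0.
    by case: nz; apply: big1 => l _; have /negbFE/eqP -> := all0 l; rewrite mul0r.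
  move=> l l' /existsP[l0 /andP[Sl0 Ml]] Mll'; apply/existsP; exists l; rewrite Mll' andbT.
  have [Mi Sl] := stepS _ Sl0; apply: Sl => //.
  by apply: contraNneq Ml => ->; rewrite Mi.
have /existsP[l /andP[/stepS[-> _]]] := S'i.
by rewrite eqxx.
Qed.

(** The minimum principle for a kernel vector and its opposite gives injectivity; for the columns of
    the inverse, whose images are unit vectors, it gives nonnegativity. *)
Lemma omit_inverse_ge0 : exists X : 'M[R]_n,
  [/\ (1%:M - M *m omit R i) *m X = 1%:M, X *m (1%:M - M *m omit R i) = 1%:M
    & forall k l, 0 <= X k l].
Proof.
set N := 1%:M - M *m omit R i.
have uN : N \in unitmx.
  rewrite -unitmx_tr -row_free_unit; apply: inj_row_free => v vN.
  have Nv : N *m v^T = 0 by rewrite -[N]trmxK -trmx_mul vN trmx0.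
  apply/rowP=> k; rewrite mxE; apply/le_anti/andP; split.
    have := @minimum_principle (- v^T) _ k; rewrite !mxE oppr_ge0; apply=> k0.
    by rewrite mulmxN Nv oppr0 mxE.
  have := @minimum_principle v^T _ k; rewrite !mxE; apply=> k0.
  by rewrite Nv mxE.
exists (invmx N); split; [exact: mulmxV | exact: mulVmx|].
move=> k l; have := @minimum_principle (col l (invmx N)) _ k; rewrite mxE; apply=> k0.
by rewrite colE mulmxA -/N mulmxV // mul1mx mxE; case: (_ && _).
Qed.

End Positivity.

Lemma omit_col (R : nzRingType) n (i : 'I_n) m (x : 'M[R]_(n, m)) k l :
  (omit R i *m x) k l = (k != i)%:R * x k l.
Proof.
rewrite /omit mulmxBl mul1mx !mxE.
rewrite (bigD1 i) //= big1 ?addr0; last by move=> j /negPf ji; rewrite mxE ji andbF mul0r.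
by rewrite mxE eqxx andbT; case: eqVneq => [->|_]; rewrite ?mul1r ?mul0r ?subrr ?subr0.
Qed.

Lemma mxBE (R : nzRingType) m n (x z : 'M[R]_(m, n)) k l : (x - z) k l = x k l - z k l.
Proof. by rewrite !mxE. Qed.

Lemma mul_scalar11 (R : nzRingType) m (x : 'M[R]_(m, 1)) c k l : (x *m c%:M) k l = x k l * c.
Proof. by rewrite !mxE big_ord1 !mxE !ord1 eqxx mulr1n. Qed.

(** * Stationary vectors over a noncommutative ring *)

Section OmitInverse.
Variables (R : nzRingType) (n : nat) (M : 'M[R]_n) (i : 'I_n) (X : 'M[R]_n).
Hypothesis NX : (1%:M - M *m omit R i) *m X = 1%:M.
Hypothesis XN : X *m (1%:M - M *m omit R i) = 1%:M.

Lemma omit_inverse_coli k : X k i = (k == i)%:R.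
Proof.
have := congr1 (fun Z : 'M_n => Z k i) XN.
by rewrite /= mulmxBr mulmx1 mulmxA mxBE omit_mxE eqxx mulr0 subr0 mxE.
Qed.

Lemma omit_inverse_row k l : X k l = (k == l)%:R + (X *m M) k l * (l != i)%:R.
Proof.
have := congr1 (fun Z : 'M_n => Z k l) XN.
rewrite /= mulmxBr mulmx1 mulmxA mxBE omit_mxE [RHS]mxE => <-.
by rewrite addrNK.
Qed.

(** Such a row is unchanged by [omit R i], hence annihilated by the invertible
    [1%:M - M *m omit R i]. Thus a fixed row is determined by its [i]-th entry. *)
Lemma omit_left_unique m (d : 'M[R]_(m, n)) : d *m M = d -> col i d = 0 -> d = 0.
Proof.
move=> dM d0; rewrite -[d]mulmx1 -NX mulmxA mulmxBr mulmx1 mulmxA dM omit_row d0.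
by rewrite mul0mx subr0 subrr mul0mx.
Qed.

Variable y : 'cV[R]_n.
Hypothesis My : M *m y = y.

(** Because y = M y, multiplying [y] by [1%:M - M *m omit R i] leaves only the omitted column [i] of
    [M], weighted by [y i 0]. *)
Lemma omit_right_fixed : y = col i (X *m M) *m (y i 0)%:M.
Proof.
have Ny : (1%:M - M *m omit R i) *m y = col i M *m (y i 0)%:M.
  rewrite omit_row mulmxBl mul1mx mulmxBl My opprB addrCA subrr addr0 -mulmxA.
  congr (_ *m _); apply/matrixP=> k l; rewrite !ord1 !mxE eqxx mulr1n.
  rewrite (bigD1 i) //= big1 ?addr0 ?mxE ?eqxx ?mul1r // => j /negPf ji.
  by rewrite mxE ji andbF mul0r.
by rewrite -[LHS]mul1mx -XN -mulmxA Ny mulmxA !colE mulmxA.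
Qed.

End OmitInverse.

Section OmitReturn.
Variables (R : unitRingType) (n : nat) (M : 'M[R]_n) (i : 'I_n) (X : 'M[R]_n).
Hypothesis XN : X *m (1%:M - M *m omit R i) = 1%:M.
Variable y : 'cV[R]_n.
Hypothesis My : M *m y = y.
Hypothesis y_unit : y i 0 \is a GRing.unit.

Lemma omit_right_col : col i (X *m M) = y *m (y i 0)^-1%:M.
Proof.
by rewrite [X in _ = X *m _](omit_right_fixed XN My) -mulmxA -scalar_mxM divrr // mulmx1.
Qed.

Lemma omit_return1 : (X *m M) i i = 1.
Proof.
transitivity (col i (X *m M) i 0); first by rewrite [RHS]mxE.
by rewrite omit_right_col mul_scalar11 divrr.
Qed.

(** Off [i] the rows agree because [X] is 1 plus [X *m M *m omit R i]; at [i] both entries are 1,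
    the one of [X *m M] by [omit_return1]. *)
Lemma omit_left_fixed : row i X *m M = row i X.
Proof.
rewrite -row_mul; apply/rowP=> l; rewrite [LHS]mxE [RHS]mxE (omit_inverse_row XN).
rewrite (eq_sym i); case: eqVneq => [->|_] /=.
  by rewrite mulr0 addr0 omit_return1.
by rewrite mulr1 add0r.
Qed.
End OmitReturn.

Section Stationary.
Variables (R : unitRingType) (n : nat) (M : 'M[R]_n) (X : 'I_n -> 'M[R]_n).
Hypothesis NX : forall i, (1%:M - M *m omit R i) *m X i = 1%:M.
Hypothesis XN : forall i, X i *m (1%:M - M *m omit R i) = 1%:M.
Variable y : 'cV[R]_n.
Hypothesis My : M *m y = y.
Hypothesis y_unit : forall i, y i 0 \is a GRing.unit.

Definition path_sum i := \sum_k X i i k.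
Hypothesis path_sum_unit : forall i, path_sum i \is a GRing.unit.

Definition stat : 'rV[R]_n := \row_i (path_sum i)^-1.

(** Both sides are fixed rows with the same [i]-th entry, since [X i i i] is 1. *)
Lemma row_omit_inverse k i : row k (X k) = (X k k i)%:M *m row i (X i).
Proof.
apply/eqP; rewrite -subr_eq0; apply/eqP.
apply: (omit_left_unique (NX i)).
  by rewrite mulmxBl -mulmxA !(omit_left_fixed (XN _) My (y_unit _)).
apply/matrixP=> a b; rewrite !ord1 mxE mxBE mul_scalar_mx [_ 0 i]mxE mxE [row _ _ _ _]mxE.
by rewrite (omit_inverse_coli (XN i)) eqxx mulr1 subrr mxE.
Qed.

Lemma row_omit_inverseE i : row i (X i) = (path_sum i)%:M *m stat.
Proof.
apply/rowP=> k; rewrite mul_scalar_mx !mxE.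
have -> : path_sum i = X i i k * path_sum k.
  rewrite /path_sum mulr_sumr; apply: eq_bigr => l _.
  have := congr1 (fun Z : 'rV_n => Z 0 l) (row_omit_inverse i k).
  by rewrite /= mul_scalar_mx !mxE.
by rewrite mulrK.
Qed.

Lemma stat_omit_inverse i : stat = (path_sum i)^-1%:M *m row i (X i).
Proof. by rewrite row_omit_inverseE mulmxA -scalar_mxM mulVr // mul1mx. Qed.

Lemma stat_fixed : stat *m M = stat.
Proof.
case: (posnP n) => [n0|n0].
  by apply/rowP=> k; have := ltn_ord k; rewrite [X in (_ < X)%N]n0.
rewrite (stat_omit_inverse (Ordinal n0)) -mulmxA.
by rewrite (omit_left_fixed (XN _) My (y_unit _)).
Qed.

Lemma stat_sum : (0 < n)%N -> \sum_k stat 0 k = 1.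
Proof.
move=> n0; rewrite (stat_omit_inverse (Ordinal n0)) mul_scalar_mx.
under eq_bigr do rewrite !mxE.
by rewrite -mulr_sumr mulVr.
Qed.

Definition mean := (stat *m y) 0 0.
Hypothesis mean_unit : mean \is a GRing.unit.

Lemma return_time i : (X i *m X i *m M) i i = path_sum i * mean * (y i 0)^-1.
Proof.
have -> : (X i *m X i *m M) i i = (row i (X i) *m col i (X i *m M)) 0 0.
  by rewrite -mulmxA !mxE; apply: eq_bigr => k _; rewrite !mxE.
rewrite (omit_right_col (XN i) My (y_unit i)) row_omit_inverseE -!mulmxA mul_scalar_mx.
by rewrite mxE mulmxA mul_scalar11 mulrA.
Qed.

Definition limit_mx : 'M[R]_n := y *m mean^-1%:M *m stat.

Lemma limit_diag i : limit_mx i i = ((X i *m X i *m M) i i)^-1.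
Proof.
have u : path_sum i * mean \is a GRing.unit by rewrite unitrMl.
rewrite return_time invrM ?unitrV // invrM // invrK.
by rewrite /limit_mx mxE big_ord1 mul_scalar11 [stat _ _]mxE !mulrA.
Qed.

Lemma limit_mul_vec : limit_mx *m y = y.
Proof.
rewrite /limit_mx -!mulmxA [stat *m y]mx11_scalar -/mean -scalar_mxM mulVr //.
by rewrite mulmx1.
Qed.

Lemma stat_mul_limit : stat *m limit_mx = stat.
Proof.
rewrite /limit_mx !mulmxA [stat *m y]mx11_scalar -/mean -scalar_mxM divrr //.
by rewrite mul1mx.
Qed.

Lemma mul_limit : M *m limit_mx = limit_mx.
Proof. by rewrite /limit_mx !mulmxA My. Qed.

Lemma limit_mul : limit_mx *m M = limit_mx.
Proof. by rewrite /limit_mx -!mulmxA stat_fixed. Qed.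

Lemma limit_idem : limit_mx *m limit_mx = limit_mx.
Proof. by rewrite {2}/limit_mx !mulmxA limit_mul_vec. Qed.

(** 1 - M differs from [1%:M - M *m omit R i] by a rank-one term, which turns [X i] into a multiple
    of its row [i]. That row is a left multiple of [stat], killed by 1 - J. So [X i] inverts 1 - M
    modulo J. *)
Lemma mul_omit_inverse i : (1%:M - M) *m X i *m (1%:M - limit_mx) = 1%:M - limit_mx.
Proof.
have -> : 1%:M - M = 1%:M - M *m omit R i - col i M *m delta_mx 0 i.
  by rewrite omit_row opprB addrCA addrAC subrr add0r.
rewrite mulmxBl NX -mulmxA -rowE mulmxBl mul1mx -mulmxA mulmxBr mulmx1.
rewrite row_omit_inverseE -[_%:M *m _ *m _]mulmxA stat_mul_limit.
by rewrite subrr mulmx0 subr0.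
Qed.

(** On this side the rank-one term produces column [i] of [X i *m M], a right multiple of [y],
    killed by 1 - J from the left. *)
Lemma omit_inverse_mul i : (1%:M - limit_mx) *m X i *m (1%:M - M) = 1%:M - limit_mx.
Proof.
have -> : 1%:M - M = 1%:M - M *m omit R i - col i M *m delta_mx 0 i.
  by rewrite omit_row opprB addrCA addrAC subrr add0r.
rewrite -mulmxA mulmxBr XN mulmxA colE mulmxA -colE (omit_right_col (XN i) My (y_unit i)).
rewrite mulmxBr mulmx1 2!mulmxA [(_ - _) *m y]mulmxBl mul1mx limit_mul_vec.
by rewrite subrr !mul0mx subr0.
Qed.

End Stationary.

Section Deviation.
Variables (R : nzRingType) (n : nat) (M J X : 'M[R]_n).
Hypothesis JJ : J *m J = J.
Hypothesis MJ : M *m J = J.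
Hypothesis JM : J *m M = J.
Hypothesis MX : (1%:M - M) *m X *m (1%:M - J) = 1%:M - J.
Hypothesis XM : (1%:M - J) *m X *m (1%:M - M) = 1%:M - J.

(* The inverse of [1 - (M - J)]: the group inverse of [1 - M] plus [J]. *)
Definition deviation := (1%:M - J) *m X *m (1%:M - J) + J.

Let D_E : 1%:M - (M - J) = 1%:M - M + J.
Proof. by rewrite opprB addrCA addrC. Qed.

Lemma mul_deviation : (1%:M - (M - J)) *m deviation = 1%:M.
Proof.
have J0 : J *m (1%:M - J) = 0 by rewrite mulmxBr mulmx1 JJ subrr.
have MJ0 : (1%:M - M) *m J = 0 by rewrite mulmxBl mul1mx MJ subrr.
have M1J : (1%:M - M) *m (1%:M - J) = 1%:M - M by rewrite mulmxBr mulmx1 MJ0 subr0.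
rewrite D_E /deviation mulmxDl [(1%:M - M) *m _]mulmxDr [J *m _]mulmxDr !mulmxA M1J MX J0 MJ0
  JJ !mul0mx addr0 add0r.
by rewrite subrK.
Qed.

Lemma deviation_mul : deviation *m (1%:M - (M - J)) = 1%:M.
Proof.
have J0 : (1%:M - J) *m J = 0 by rewrite mulmxBl mul1mx JJ subrr.
have MJ0 : J *m (1%:M - M) = 0 by rewrite mulmxBr mulmx1 JM subrr.
have M1J : (1%:M - J) *m (1%:M - M) = 1%:M - M by rewrite mulmxBl mul1mx MJ0 subr0.
rewrite D_E /deviation mulmxDr [_ *m (1%:M - M)]mulmxDl [_ *m J]mulmxDl -!mulmxA M1J J0 MJ0 JJ
  !mulmx0 addr0 add0r.
by rewrite mulmxA XM subrK.
Qed.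

End Deviation.

(** * Fixed vectors of matrices with column sums 1 *)

Section ColumnStochastic.
Variables (R : nzRingType) (m : nat) (Q U : 'M[R]_m) (k0 : 'I_m).
Hypothesis Q1 : const_mx 1 *m Q = const_mx 1 :> 'rV[R]_m.
Hypothesis NU : (1%:M - omit R k0 *m Q) *m U = 1%:M.

(** By the choice of [U] the two columns agree off [k0]; column sums 1 give them the same total, so
    they agree at [k0] as well. *)
Lemma stochastic_right_fixed : Q *m col k0 U = col k0 U.
Proof.
set u := col k0 U.
have uE k : u k 0 = (k == k0)%:R + (k != k0)%:R * (Q *m u) k 0.
  have : (1%:M - omit R k0 *m Q) *m u = delta_mx k0 0 by rewrite /u colE mulmxA NU mul1mx.
  move=> /(congr1 (fun Z : 'cV_m => Z k 0)); rewrite /= mulmxBl mul1mx mxBE -mulmxA omit_col.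
  by rewrite [delta_mx _ _ _ _]mxE eqxx andbT => <-; rewrite addrNK.
have sumE : \sum_k (Q *m u) k 0 = \sum_k u k 0.
  have sE (v : 'cV[R]_m) : \sum_k v k 0 = ((const_mx 1 : 'rV_m) *m v) 0 0.
    by rewrite mxE; apply: eq_bigr => k _; rewrite mxE mul1r.
  by rewrite !sE mulmxA Q1.
have neq k : k != k0 -> (Q *m u) k 0 = u k 0.
  by move=> kk; rewrite [RHS]uE kk (negPf kk) mul1r add0r.
apply/colP=> k; have [->|] := eqVneq k k0; last exact: neq.
by move: sumE; rewrite (bigD1 k0) //= [RHS](bigD1 k0) //= (eq_bigr _ neq) => /addIr.
Qed.

(** Subtracting a left multiple of the fixed row of ones leaves a fixed row vanishing at [k0], and
    [NU] forces it to be 0. *)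
Lemma stochastic_left_unique (d : 'rV[R]_m) : d *m Q = d -> forall k, d 0 k = d 0 k0.
Proof.
move=> dQ; pose e := d - (d 0 k0)%:M *m const_mx 1.
have e0 : col k0 e = 0.
  by apply/matrixP=> a b; rewrite !ord1 !mxE big_ord1 !mxE eqxx mulr1 subrr.
have eQ : e *m Q = e by rewrite mulmxBl dQ -mulmxA Q1.
have : e = 0.
  rewrite -[e]mulmx1 -NU mulmxA mulmxBr mulmx1 mulmxA omit_row e0 mul0mx subr0 eQ.
  by rewrite subrr mul0mx.
move=> + k => /(congr1 (fun Z : 'rV_m => Z 0 k)); rewrite /= /e mul_scalar_mx !mxE mulr1.
by move/eqP; rewrite subr_eq0 => /eqP.
Qed.

End ColumnStochastic.

(** * Evaluation at t = 1 *)

Section EvalAtOne.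
Variables (D K : unitRingType) (j : {rmorphism {poly D} -> K}).
Hypothesis skD : skew_field D.
Hypothesis hK : is_fraction_field j.

Let skK : skew_field K. Proof. by case: hK. Qed.
Let j_inj : injective j. Proof. by case: hK. Qed.

Lemma horner1M (p q : {poly D}) : (p * q).[1] = p.[1] * q.[1].
Proof. by rewrite hornerM_comm // /comm_poly mul1r mulr1. Qed.

Lemma horner1_neq0 (p : {poly D}) : p.[1] != 0 -> p != 0.
Proof. by apply: contraNneq => ->; rewrite horner0. Qed.

Lemma fraction_unit (p : {poly D}) : p != 0 -> j p \is a GRing.unit.
Proof. by move=> p0; apply: skK; rewrite -(rmorph0 j) (inj_eq j_inj). Qed.

Lemma fraction_unit1 (p : {poly D}) : p.[1] != 0 -> j p \is a GRing.unit.
Proof. by move/horner1_neq0/fraction_unit. Qed.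

Lemma skew_mulf_neq0 (x y : D) : x != 0 -> y != 0 -> x * y != 0.
Proof.
move=> x0 y0; apply: contraNneq y0 => xy.
by rewrite -[y](mulKr (skD x0)) xy mulr0.
Qed.

Lemma divX1 (p : {poly D}) : p != 0 -> p.[1] = 0 ->
  exists2 p', p = p' * ('X - 1%:P) & (size p' < size p)%N.
Proof.
move=> p0 /eqP/factor_theorem[p' pE]; exists p' => //.
have p'0 : p' != 0 by apply: contraNneq p0; rewrite pE => ->; rewrite mul0r.
by rewrite pE size_Mmonic ?monicXsubC // size_XsubC addn2.
Qed.

(** A common right multiple comes from [K]; the point is to keep V(1) nonzero. If V(1) = 0, then
    R(1) U(1) = 0, so U(1) = 0, and a right factor X - 1 cancels from both [U] and [V], lowering the
    size of [V]. *)
Lemma ore_at1 (Q R : {poly D}) : R.[1] != 0 ->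
  exists U V : {poly D}, V.[1] != 0 /\ R * U = Q * V.
Proof.
move=> R1.
have [U [V [V0 eUV]]] : exists U V : {poly D}, V != 0 /\ R * U = Q * V.
  case: hK => _ _ /(_ ((j R)^-1 * j Q))[U [V [V0 e]]]; exists U, V; split=> //.
  apply: j_inj; rewrite !rmorphM -[j U](divrK (fraction_unit V0)) -e.
  by rewrite !mulrA divrr ?mul1r // fraction_unit1.
have [s] := ubnP (size V); elim: s => // s IHs in U V V0 eUV *.
rewrite ltnS => Vs; have [V1|] := eqVneq V.[1] 0; last by exists U, V.
have [V' VE V's] := divX1 V0 V1.
have U1 : U.[1] = 0.
  apply/eqP; apply: contraTT isT => U1; apply/negP.
  have /eqP := congr1 (fun p => p.[1]) eUV; rewrite /= !horner1M V1 mulr0.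
  by rewrite (negPf (skew_mulf_neq0 R1 U1)).
have /factor_theorem[U' UE] : root U 1 by apply/eqP.
apply: (IHs U' V'); last exact: leq_trans Vs.
  by apply: contraNneq V0; rewrite VE => ->; rewrite mul0r.
by move: eUV; rewrite VE UE !mulrA => /(rreg_lead _); apply; rewrite (monicP (monicXsubC _));
  exact: rreg1.
Qed.

Lemma factor_X1 (Q : {poly D}) : Q != 0 ->
  exists m Q', Q'.[1] != 0 /\ Q = (1 - 'X) ^+ m * Q'.
Proof.
have [s] := ubnP (size Q); elim: s => // s IHs in Q *.
rewrite ltnS => Qs Q0; have [Q1|] := eqVneq Q.[1] 0; last first.
  by exists 0%N, Q; rewrite expr0 mul1r.
have [Q' QE Q's] := divX1 Q0 Q1.
have [||m [Q'' [Q''1 Q'E]]] := IHs Q'; first exact: leq_trans Qs.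
  by apply: contraNneq Q0; rewrite QE => ->; rewrite mul0r.
exists m.+1, (- Q''); split; first by rewrite hornerN oppr_eq0.
rewrite QE Q'E exprSr -!mulrA; congr (_ * _).
rewrite mulrN -mulNr opprB mulrBr mulrBl; congr (_ - _); first exact: commr_polyX.
by rewrite mulr1 mul1r.
Qed.

(** A fraction without pole at 1 together with its value. Working with pairs makes the value a
    projection, hence a ring morphism, with no need to check independence of the representation. *)
Definition regular1 (x : K * D) := exists Q R : {poly D},
  [/\ R.[1] != 0, x.1 = j Q / j R & x.2 = Q.[1] / R.[1]].

Lemma regular1_eval x : regular1 x -> eval_at1 j x.1 x.2.
Proof.
case=> Q [R [R1 -> ->]]; have [->|Q0] := eqVneq Q 0.
  by left; rewrite rmorph0 horner0 !mul0r.
have [m [Q' [Q'1 ->]]] := factor_X1 Q0; right; exists m, Q', R; split=> //.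
  by rewrite rmorphM rmorphXn.
rewrite horner1M; case: m => [|m] /=; first by rewrite expr0 hornerC mul1r.
by rewrite exprS horner1M hornerD hornerN hornerC hornerX subrr !mul0r.
Qed.

Lemma regular1_poly (Q : {poly D}) : regular1 (j Q, Q.[1]).
Proof. by exists Q, 1; rewrite rmorph1 hornerC !divr1 oner_neq0. Qed.

Lemma regular1N x : regular1 x -> regular1 (- x).
Proof.
by case=> Q [R [R1 e1 e2]]; exists (- Q), R; rewrite [j (- Q)]rmorphN hornerN !mulNr -e1 -e2.
Qed.

Lemma regular1D x y : regular1 x -> regular1 y -> regular1 (x + y).
Proof.
case=> Q [R [R1 e1 e2]] [Q' [R' [R'1 e1' e2']]].
have [U [V [V1 UV]]] := ore_at1 R' R1.
have RU1 : (R * U).[1] != 0 by rewrite UV horner1M skew_mulf_neq0.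
have U1 : U.[1] != 0.
  by apply: contraNneq RU1; rewrite horner1M => ->; rewrite mulr0.
exists (Q * U + Q' * V), (R * U); split=> //.
  rewrite /= e1 e1' rmorphD mulrDl {2}UV !rmorphM !invrM ?fraction_unit1 //.
  by rewrite !mulrA !mulrK ?fraction_unit1.
rewrite /= e2 e2' hornerD mulrDl {2}UV !horner1M !invrM ?skD //.
by rewrite !mulrA !mulrK ?skD.
Qed.

Lemma regular1M x y : regular1 x -> regular1 y -> regular1 (x * y).
Proof.
case=> Q [R [R1 e1 e2]] [Q' [R' [R'1 e1' e2']]].
have [U [V [V1 UV]]] := ore_at1 Q' R1.
exists (Q * U), (R' * V); split; first by rewrite horner1M skew_mulf_neq0.
  rewrite /= e1 e1' !rmorphM invrM ?fraction_unit1 //.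
  have -> : j U = (j R)^-1 * j Q' * j V by rewrite -mulrA -rmorphM -UV rmorphM mulKr
    ?fraction_unit1.
  by rewrite !mulrA mulrK ?fraction_unit1.
rewrite /= e2 e2' !horner1M invrM ?skD //.
have -> : U.[1] = R.[1]^-1 * Q'.[1] * V.[1] by rewrite -mulrA -horner1M -UV horner1M mulKr ?skD.
by rewrite !mulrA mulrK ?skD.
Qed.

Lemma regular1V x : regular1 x -> x.2 = 1 ->
  exists y, [/\ regular1 y, x * y = 1 & y * x = 1].
Proof.
case=> Q [R [R1 e1 e2]] x2.
have QR : Q.[1] = R.[1] by rewrite -[LHS](divrK (skD R1)) -e2 x2 mul1r.
have Q1 : Q.[1] != 0 by rewrite QR.
exists (j R / j Q, 1); split.
- by exists R, Q; split=> //=; rewrite QR divrr ?skD.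
- rewrite [x]surjective_pairing x2 e1; congr (_, _); last exact: mulr1.
  by rewrite /= mulrA divrK ?divrr ?fraction_unit1.
- rewrite [x]surjective_pairing x2 e1; congr (_, _); last exact: mulr1.
  by rewrite /= mulrA divrK ?divrr ?fraction_unit1.
Qed.

Lemma fractionX_central (f : K) : GRing.comm (j 'X) f.
Proof.
case: hK => _ _ /(_ f)[Q [R [R0 ->]]].
have cX p : GRing.comm (j 'X) (j p) by rewrite /GRing.comm -!rmorphM commr_polyX.
by apply: commrM => //; apply: commrV.
Qed.

Lemma scalemx_central m n p (t : K) (A : 'M[K]_(m, n)) (B : 'M[K]_(n, p)) :
  (forall f, GRing.comm t f) -> A *m (t *: B) = t *: (A *m B).
Proof.
move=> ct; apply/matrixP=> k l; rewrite !mxE mulr_sumr; apply: eq_bigr => i _.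
by rewrite mxE !mulrA ct.
Qed.

(* With [W = 1 - t (P - J)], which is invertible at [t = 1], one has
   [(1 - t P)^-1 = W^-1 - J + (1 - t)^-1 J]. *)
Lemma star_eval_at1 n (P J H : 'M[D]_n) :
  J *m J = J -> P *m J = J -> J *m P = J ->
  (1%:M - (P - J)) *m H = 1%:M -> H *m (1%:M - (P - J)) = 1%:M ->
  exists S, is_star_mx j P S /\ forall k l, eval_at1 j (((1 - j 'X) *: S) k l) (J k l).
Proof.
move=> JJ PJ JP WH HW.
pose cst m1 m2 (A : 'M[D]_(m1, m2)) : 'M[K]_(m1, m2) := map_mx (j \o polyC) A.
pose W : 'M[{poly D}]_n := 1%:M - 'X *: map_mx polyC (P - J).
pose WT : 'M[K * D]_n := \matrix_(k, l) (j (W k l), (W k l).[1]).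
pose HT : 'M[K * D]_n := \matrix_(k, l) (j (H k l)%:P, (H k l)%:P.[1]).
have sWT : map_mx snd WT = 1%:M - (P - J).
  apply/matrixP=> k l; rewrite !mxE /= hornerD hornerN hornerMn hornerC.
  by rewrite horner1M hornerX mul1r hornerC.
have sHT : map_mx snd HT = H by apply/matrixP=> k l; rewrite !mxE /= hornerC.
(* [H] inverts [W] at t = 1 and is carried along as a constant matrix, so that [W] gets an inverse
   over [K] with regular entries. *)
have [|||||||||Y [rY WY YW]] := @lift_inverse_mod _ _ regular1 (@snd K D) _ _ _ _ _ n WT HT.
- by have := regular1_poly 1; rewrite rmorph1 hornerC.
- exact: regular1N.
- exact: regular1D.
- exact: regular1M.
- exact: regular1V.
- by move=> k l; rewrite mxE; exact: regular1_poly.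
- by move=> k l; rewrite mxE; exact: regular1_poly.
- by rewrite sWT sHT.
- by rewrite sWT sHT.
pose Z := map_mx fst Y; set t := j 'X; set a := 1 - t.
have ct : forall f, GRing.comm t f := fractionX_central.
have ca f : GRing.comm a f by apply/commr_sym/commrB; [exact: commr1 | exact/commr_sym].
have cst_mul m1 m2 m3 (A : 'M_(m1, m2)) (B : 'M_(m2, m3)) : cst _ _ (A *m B) = cst _ _ A *m
  cst _ _ B.
  exact: map_mxM.
have cW : map_mx fst WT = 1%:M - t *: cst _ _ P + t *: cst _ _ J.
  rewrite -addrA (addrC (- _)) -opprB -scalerBr; apply/matrixP=> k l.
  rewrite !mxE /= rmorphB rmorphM rmorphMn rmorph1 -/t; congr (_ - _ * _).
  by rewrite polyCB rmorphB.
set Jc := cst _ _ J in cW; set Pc := cst _ _ P in cW.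
have WZ : map_mx fst WT *m Z = 1%:M by rewrite -map_mxM WY map_mx1.
have ZW : Z *m map_mx fst WT = 1%:M by rewrite -map_mxM YW map_mx1.
have JJc : Jc *m Jc = Jc by rewrite -cst_mul JJ.
have PJc : Pc *m Jc = Jc by rewrite -cst_mul PJ.
have JPc : Jc *m Pc = Jc by rewrite -cst_mul JP.
have JZ : Jc *m Z = Jc.
  have {1}<- : Jc *m map_mx fst WT = Jc.
    rewrite cW mulmxDr mulmxBr mulmx1 !scalemx_central // JPc JJc.
    by rewrite addrNK.
  by rewrite -mulmxA WZ mulmx1.
have ZJ : Z *m Jc = Jc.
  have {1}<- : map_mx fst WT *m Jc = Jc.
    by rewrite cW mulmxDl mulmxBl mul1mx -!scalemxAl PJc JJc addrNK.
  by rewrite mulmxA ZW mul1mx.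
have au : a \is a GRing.unit.
  rewrite /a -(rmorph1 j) -rmorphB; apply: fraction_unit.
  by rewrite -oppr_eq0 opprB monic_neq0 // -polyC1 monicXsubC.
have cav f : GRing.comm a^-1 f by apply/commr_sym/commrV/commr_sym.
have TE : 1%:M - t *: Pc = map_mx fst WT - t *: Jc by rewrite cW addrK.
have aJ : Jc - t *: Jc = a *: Jc by rewrite /a scalerBl scale1r.
have cancel : 1%:M - t *: Jc - a *: Jc + Jc = 1%:M.
  by rewrite -aJ opprB addrA !subrK.
exists (Z - Jc + a^-1 *: Jc); split.
  split; rewrite -/t -/(cst _ _ P) -/Pc.
    rewrite mulmxDr mulmxBr scalemx_central //.
    have -> : (1%:M - t *: Pc) *m Jc = a *: Jc by rewrite mulmxBl mul1mx -scalemxAl PJc.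
    have -> : (1%:M - t *: Pc) *m Z = 1%:M - t *: Jc by rewrite TE mulmxBl WZ -scalemxAl JZ.
    by rewrite scalerA mulVr // scale1r cancel.
  rewrite mulmxDl mulmxBl -scalemxAl.
  have -> : Jc *m (1%:M - t *: Pc) = a *: Jc by rewrite mulmxBr mulmx1 scalemx_central // JPc.
  have -> : Z *m (1%:M - t *: Pc) = 1%:M - t *: Jc by rewrite TE mulmxBr ZW scalemx_central //
    ZJ.
  by rewrite scalerA mulVr // scale1r cancel.
move=> k l; rewrite scalerDr scalerA mulrV // scale1r.
have rJ : regular1 (Jc k l, J k l) by have := regular1_poly (J k l)%:P; rewrite hornerC mxE.
(* (1 - t) S = (1 - t) (Z - J) + J, where Z - J is regular and 1 - t has value 0. *)
have rE : regular1 ((a, 0) * (Y k l - (Jc k l, J k l)) + (Jc k l, J k l)).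
  apply: regular1D => //; apply: regular1M; last by apply: regular1D => //; exact: regular1N.
  have := regular1_poly (1 - 'X).
  by rewrite rmorphB rmorph1 hornerD hornerN hornerX hornerC subrr.
have := regular1_eval rE; rewrite /= mul0r add0r; congr (eval_at1 j _ _).
by rewrite !mxE.
Qed.

End EvalAtOne.

(** * Formal power series *)

Section SeriesRing.
Variable A : choiceType.
Implicit Types (S T U : series A) (w : seq A).

HB.instance Definition _ := gen_eqMixin (series A).
HB.instance Definition _ := gen_choiceMixin (series A).

Lemma seriesP S T : S =1 T -> S = T. Proof. by move=> e; apply/funext. Qed.

Definition series_add S T : series A := fun w => S w + T w.
Definition series_opp S : series A := fun w => - S w.
Definition series0 : series A := fun _ => 0.

Lemma series_addA : associative series_add.
Proof. by move=> S T U; apply/seriesP=> w; exact: addrA. Qed.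
Lemma series_addC : commutative series_add.
Proof. by move=> S T; apply/seriesP=> w; exact: addrC. Qed.
Lemma series_add0 : left_id series0 series_add.
Proof. by move=> S; apply/seriesP=> w; exact: add0r. Qed.
Lemma series_addN : left_inverse series0 series_opp series_add.
Proof. by move=> S; apply/seriesP=> w; exact: addNr. Qed.

HB.instance Definition _ :=
  GRing.isZmodule.Build (series A) series_addA series_addC series_add0 series_addN.

Definition shift a S : series A := fun w => S (a :: w).

Lemma series_mul_nil S T : series_mul S T [::] = S [::] * T [::].
Proof. by rewrite /series_mul big_ord1. Qed.

Lemma series_mul_cons S T a w :
  series_mul S T (a :: w) = S [::] * T (a :: w) + series_mul (shift a S) T w.
Proof. by rewrite /series_mul big_ord_recl. Qed.

Lemma series_mulDl : left_distributive (@series_mul A) +%R.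
Proof.
move=> S T U; apply/seriesP => w; rewrite /series_mul -[RHS]big_split /=.
by apply: eq_bigr => k _; rewrite mulrDl.
Qed.

Lemma series_mulDr : right_distributive (@series_mul A) +%R.
Proof.
move=> S T U; apply/seriesP => w; rewrite /series_mul -[RHS]big_split /=.
by apply: eq_bigr => k _; rewrite mulrDr.
Qed.

Lemma series_mulA : associative (@series_mul A).
Proof.
move=> S T U; apply/seriesP => w; elim: w S => [|a w IHw] S.
  by rewrite !series_mul_nil mulrA.
rewrite !series_mul_cons mulrDr -addrA mulrA series_mul_nil; congr (_ + _).
have -> : shift a (series_mul S T) = ((fun w => S [::] * shift a T w) : series A) + series_mul
  (shift a S) T.
  by apply/seriesP => v; rewrite /shift series_mul_cons.
rewrite series_mulDl IHw; congr (_ + _); rewrite /series_mul mulr_sumr.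
by apply: eq_bigr => k _; rewrite mulrA.
Qed.

Lemma series_mul1l : left_id (@series1 A) (@series_mul A).
Proof.
move=> S; apply/seriesP => -[|a w]; first by rewrite series_mul_nil mul1r.
rewrite series_mul_cons mul1r /series_mul big1 ?addr0 // => k _.
by rewrite /shift /series1 mul0r.
Qed.

Lemma series_mul1r : right_id (@series1 A) (@series_mul A).
Proof.
move=> S; apply/seriesP => w; elim: w S => [|a w IHw] S.
  by rewrite series_mul_nil mulr1.
by rewrite series_mul_cons IHw mulr0 add0r.
Qed.

Lemma series1_neq0 : @series1 A != 0.
Proof. by apply/eqP => /(congr1 (fun S : series A => S [::])). Qed.

HB.instance Definition _ := GRing.Zmodule_isNzRing.Build (series A)
  series_mulA series_mul1l series_mul1r series_mulDl series_mulDr series1_neq0.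

Lemma seriesDE S T w : (S + T) w = S w + T w. Proof. by []. Qed.
Lemma seriesNE S w : (- S) w = - S w. Proof. by []. Qed.
Lemma series1E w : (1 : series A) w = (w == [::])%:R. Proof. by []. Qed.
Lemma seriesME S T w : (S * T) w = \sum_(k < (size w).+1) S (take k w) * T (drop k w).
Proof. by []. Qed.
Lemma seriesM_nil S T : (S * T) [::] = S [::] * T [::]. Proof. exact: series_mul_nil. Qed.
Lemma seriesM_cons S T a w : (S * T) (a :: w) = S [::] * T (a :: w) + (shift a S * T) w.
Proof. exact: series_mul_cons. Qed.

Definition series_scale (c : rat) S : series A := fun w => c * S w.

Lemma series_scaleA c d S : series_scale c (series_scale d S) = series_scale (c * d) S.
Proof. by apply/seriesP=> w; exact: mulrA. Qed.
Lemma series_scale1 : left_id 1 series_scale.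
Proof. by move=> S; apply/seriesP=> w; exact: mul1r. Qed.
Lemma series_scaleDr : right_distributive series_scale +%R.
Proof. by move=> c S T; apply/seriesP=> w; exact: mulrDr. Qed.
Lemma series_scaleDl S : {morph series_scale^~ S : c d / c + d}.
Proof. by move=> c d; apply/seriesP=> w; exact: mulrDl. Qed.
HB.instance Definition _ := GRing.Zmodule_isLmodule.Build rat (series A)
  series_scaleA series_scale1 series_scaleDr series_scaleDl.

Lemma seriesZE c S w : (c *: S) w = c * S w. Proof. by []. Qed.

Lemma series_scaleAl c S T : c *: (S * T) = (c *: S) * T.
Proof.
apply/seriesP=> w; rewrite seriesZE !seriesME mulr_sumr.
by apply: eq_bigr => k _; rewrite seriesZE mulrA.
Qed.
HB.instance Definition _ := GRing.Lmodule_isLalgebra.Build rat (series A) series_scaleAl.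

Lemma series_scaleAr c S T : c *: (S * T) = S * (c *: T).
Proof.
apply/seriesP=> w; rewrite seriesZE !seriesME mulr_sumr.
by apply: eq_bigr => k _; rewrite seriesZE mulrCA.
Qed.
HB.instance Definition _ := GRing.Lalgebra_isAlgebra.Build rat (series A) series_scaleAr.

Definition series_letter (a : A) : series A := fun w => (w == [:: a])%:R.

Lemma series_letterM_nil a S : (series_letter a * S) [::] = 0.
Proof. by rewrite seriesM_nil mul0r. Qed.

Lemma series_letterM_cons a S b w : (series_letter a * S) (b :: w) = (a == b)%:R * S w.
Proof.
rewrite seriesM_cons mul0r add0r.
have -> : shift b (series_letter a) = (a == b)%:R *: 1.
  apply/seriesP=> v; rewrite seriesZE series1E /shift /series_letter eqseq_cons eq_sym.
  by rewrite -mulnb natrM.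
by rewrite -series_scaleAl mul1r.
Qed.

Lemma series_sumE I (r : seq I) (P : pred I) (F : I -> series A) w :
  (\sum_(i <- r | P i) F i) w = \sum_(i <- r | P i) F i w.
Proof. by elim/big_rec2: _ => // i x y _ <-; rewrite seriesDE. Qed.

Definition coef0 S : rat := S [::].
Lemma coef0_additive : {morph coef0 : x y / x - y}. Proof. by []. Qed.
Lemma coef0_monoid : monoid_morphism coef0.
Proof. by split=> // S T; exact: seriesM_nil. Qed.
HB.instance Definition _ := GRing.isZmodMorphism.Build (series A) rat coef0 coef0_additive.
HB.instance Definition _ := GRing.isMonoidMorphism.Build (series A) rat coef0 coef0_monoid.

(** Locality of the product: it allows a star to be replaced by a finite geometric sum at each
    word. *)
Lemma eq_seriesMr S U U' w : (forall v, (size v <= size w)%N -> U v = U' v) ->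
  (S * U) w = (S * U') w.
Proof. by move=> e; apply: eq_bigr => k _; rewrite e // size_drop leq_subr. Qed.

Lemma eq_seriesMl S U U' w : (forall v, (size v <= size w)%N -> U v = U' v) ->
  (U * S) w = (U' * S) w.
Proof. by move=> e; apply: eq_bigr => k _; rewrite e // size_take_min geq_minr. Qed.

Lemma series_expE S m : series_exp S m = S ^+ m.
Proof. by elim: m => [|m IHm] //; rewrite exprS -IHm. Qed.

Lemma proper_exp_eq0 S m w : S [::] = 0 -> (size w < m)%N -> (S ^+ m) w = 0.
Proof.
move=> S0; elim: m w => // m IHm [|a w] wm; rewrite exprS.
  by rewrite seriesM_nil S0 mul0r.
rewrite seriesM_cons S0 mul0r add0r.
rewrite (@eq_seriesMr _ _ 0) ?mulr0 // => v vw; apply: IHm.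
exact: leq_ltn_trans vw _.
Qed.

Lemma series_star_geom S N w : S [::] = 0 -> (size w < N)%N ->
  series_star S w = (\sum_(m < N) S ^+ m) w.
Proof.
move=> S0 wN; rewrite /series_star series_sumE.
rewrite (big_ord_widen N (fun m => series_exp S m w)) // big_mkcond; apply: eq_bigr => m _.
by rewrite series_expE; case: ltnP => // /(proper_exp_eq0 S0)->.
Qed.

Lemma series_starP S : S [::] = 0 ->
  (1 - S) * series_star S = 1 /\ series_star S * (1 - S) = 1.
Proof.
move=> S0; have geom N : (1 - S) * \sum_(m < N) S ^+ m = 1 - S ^+ N.
  by rewrite -opprB mulNr -subrX1 opprB.
have comm N : (1 - S) * \sum_(m < N) S ^+ m = (\sum_(m < N) S ^+ m) * (1 - S).
  apply/commr_sum => m _; apply/commrX/commr_sym/commrB; [exact: commr1 | by []].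
split; apply/seriesP => w.
  rewrite (@eq_seriesMr _ _ (\sum_(m < (size w).+1) S ^+ m)); last first.
    by move=> v vw; apply: series_star_geom.
  by rewrite geom seriesDE seriesNE (proper_exp_eq0 S0) // subr0.
rewrite (@eq_seriesMl _ _ (\sum_(m < (size w).+1) S ^+ m)); last first.
  by move=> v vw; apply: series_star_geom.
by rewrite -comm geom seriesDE seriesNE (proper_exp_eq0 S0) // subr0.
Qed.

End SeriesRing.

(** * Specializations of the free field *)

Section LetterEvaluation.
Variables (A : choiceType) (h : A -> rat).

Definition monom_eval (m : {fmonom A}) : rat := \prod_(a <- (m : seq A)) h a.

Lemma monom_eval_morphism : mmorphism monom_eval.
Proof.
split=> [m1 m2|]; last by rewrite /monom_eval fm1 big_nil.
by rewrite /monom_eval fmM big_cat.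
Qed.
HB.instance Definition _ := isMultiplicative.Build {fmonom A} rat monom_eval
  monom_eval_morphism.

(** The codomain is Q as an algebra over itself, so that the universal property of a free field
    applies to this morphism. *)
Definition letter_eval (p : ncpoly A) : rat^o := mmap idfun monom_eval (p : {malg rat[{fmonom
  A}]}).

Lemma letter_eval_additive : {morph letter_eval : x y / x - y}.
Proof. exact: mmapB. Qed.
HB.instance Definition _ :=
  GRing.isZmodMorphism.Build (ncpoly A) rat^o letter_eval letter_eval_additive.
Lemma letter_eval_monoid : monoid_morphism letter_eval.
Proof.
split; first exact: mmap1.
by have [m1 _] := @mmap_is_multiplicative {fmonom A} rat rat idfun monom_eval.
Qed.
HB.instance Definition _ :=
  GRing.isMonoidMorphism.Build (ncpoly A) rat^o letter_eval letter_eval_monoid.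
Lemma letter_eval_scalable : scalable letter_eval.
Proof. by move=> c p; rewrite /letter_eval mmapZ. Qed.
HB.instance Definition _ :=
  GRing.isScalable.Build rat (ncpoly A) rat^o *:%R letter_eval letter_eval_scalable.

Lemma letter_evalE a : letter_eval (letter a) = h a.
Proof. by rewrite /letter_eval /letter mmapU /= mul1r /monom_eval fmuE big_seq1. Qed.

End LetterEvaluation.

Section Transfer.
Variables (A : choiceType) (B : algType rat) (F : unitAlgType rat).
Variables (iota : {lrmorphism B -> F}) (q : ncpoly A -> B).
Variables (D : unitAlgType rat) (m : {lrmorphism B -> D}).
Hypotheses (hF : is_free_field iota) (skD : skew_field D).

(** By induction the value in [F] stays in the domain [O] of the specialization and [mbar] sends it
    to the value in [D]; where the latter is nonzero, so is the former, and its inverse is in [O]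
    again. *)
Lemma free_field_rval e v : rval (m \o q) e = Some v -> exists f, rval (iota \o q) e = Some f.
Proof.
have [skF _ _ /(_ D m skD)[O [mbar [[[_ OL OM] Oi] [mb1 mbM] mbZ mbi mbV]]]] := hF.
have O0 : 0 \in O by have := Oi 0; rewrite rmorph0.
have O1 : 1 \in O by have := Oi 1; rewrite rmorph1.
have mb0 : mbar 0 = 0 by have := mbi 0; rewrite !rmorph0.
suff IH : forall e v, rval (m \o q) e = Some v ->
    exists f, [/\ rval (iota \o q) e = Some f, f \in O & mbar f = v].
  by move/IH=> [f [ef _ _]]; exists f.
elim=> {e v} [p|e1 IH1 e2 IH2|e1 IH1 e2 IH2|e1 IH1] v /=.
- by move=> [<-]; exists (iota (q p)); rewrite Oi mbi.
- case: (rval _ e1) IH1 => // x /(_ _ erefl)[f [-> fO <-]].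
  case: (rval _ e2) IH2 => // y /(_ _ erefl)[g [-> gO <-]] [<-].
  exists (f + g); split=> //; first by have := OL 1 f g fO gO; rewrite scale1r.
  by have := mbZ 1 f g fO gO; rewrite !scale1r.
- case: (rval _ e1) IH1 => // x /(_ _ erefl)[f [-> fO <-]].
  case: (rval _ e2) IH2 => // y /(_ _ erefl)[g [-> gO <-]] [<-].
  by exists (f * g); split=> //; [exact: OM | exact: mbM].
- case: (rval _ e1) IH1 => // x /(_ _ erefl)[f [-> fO <-]].
  case: eqP => // /eqP mf0 [<-].
  have f0 : f != 0 by apply: contraNneq mf0 => ->; rewrite mb0.
  rewrite (negPf f0); exists f^-1; split=> //; first exact: mbV.
  by apply: (mulIr (skD mf0)); rewrite -mbM ?mbV // !mulVr ?skD ?skF // mb1.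
Qed.
End Transfer.

Section Descent.
Variables (E B D : algType rat) (r : E) (q : {lrmorphism E -> B}).
Hypothesis hB : is_quotient r q.

Lemma quotient_lift (m : {lrmorphism E -> D}) : m r = 0 ->
  exists m' : {lrmorphism B -> D}, forall p, m' (q p) = m p.
Proof.
move=> mr; have [q_surj q_ker] := hB.
have mker p p' : q p = q p' -> m p = m p'.
  move=> e; apply/eqP; rewrite -subr_eq0 -rmorphB.
  have /q_ker[s ->] : q (p - p') = 0 by rewrite rmorphB /= e subrr.
  by rewrite rmorph_sum big1 // => uv _; rewrite !rmorphM /= mr mulr0 mul0r.
pose g b := m (projT1 (cid (q_surj b))).
have gE p : g (q p) = m p by apply: mker; case: cid.
have g_add : {morph g : x y / x - y}.
  by move=> x y; have [[p <-] [p' <-]] := (q_surj x, q_surj y); rewrite -rmorphB !gE rmorphB.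
have g_mon : monoid_morphism g.
  split; first by rewrite -(rmorph1 q) gE rmorph1.
  by move=> x y; have [[p <-] [p' <-]] := (q_surj x, q_surj y); rewrite -rmorphM !gE rmorphM.
have g_scal : scalable g.
  by move=> c x; have [p <-] := q_surj x; rewrite -linearZ !gE linearZ.
pose gA := GRing.isZmodMorphism.Build B D g g_add.
pose gM := GRing.isMonoidMorphism.Build B D g g_mon.
pose gZ := GRing.isScalable.Build rat B D *:%R g g_scal.
pose G : {lrmorphism B -> D} := HB.pack g gA gM gZ.
by exists G.
Qed.

End Descent.

(** * One rational expression evaluated in three skew fields *)

Section JointEvaluation.
Variables (A : choiceType) (F D G : unitRingType).
Variables (iota : {rmorphism ncpoly A -> F}) (phi : {rmorphism ncpoly A -> D}).
Variable chi : {rmorphism ncpoly A -> G}.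
Hypotheses (skF : skew_field F) (skD : skew_field D) (skG : skew_field G).
Hypothesis chi_phi : forall e v, rval chi e = Some v -> exists f, rval phi e = Some f.
Hypothesis chi_iota : forall e v, rval chi e = Some v -> exists f, rval iota e = Some f.

(* The third component decides: a rational expression that can be computed in [G] can
   be computed in [D] and in [F] as well. *)
Definition joint (x : F * D * G) := exists e,
  [/\ rval iota e = Some x.1.1, rval phi e = Some x.1.2 & rval chi e = Some x.2].

Definition joint_eta (p : ncpoly A) : F * D * G := (iota p, phi p, chi p).

Lemma joint_poly p : joint (joint_eta p).
Proof. by exists (RPoly p). Qed.

Lemma joint1 : joint 1.
Proof. by have := joint_poly 1; rewrite /joint_eta !rmorph1. Qed.

Lemma jointD x y : joint x -> joint y -> joint (x + y).
Proof.
by move=> [e [e1 e2 e3]] [e' [e1' e2' e3']]; exists (RAdd e e') => /=;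
  rewrite e1 e2 e3 e1' e2' e3'.
Qed.

Lemma jointM x y : joint x -> joint y -> joint (x * y).
Proof.
by move=> [e [e1 e2 e3]] [e' [e1' e2' e3']]; exists (RMul e e') => /=;
  rewrite e1 e2 e3 e1' e2' e3'.
Qed.

Lemma jointN x : joint x -> joint (- x).
Proof.
move=> jx; rewrite -mulN1r; apply: jointM => //.
by have := joint_poly (- 1); rewrite /joint_eta !rmorphN1.
Qed.

(** [RInv e] can be computed in [G], hence in the other two fields; in particular the values of [e]
    there are nonzero. *)
Lemma jointV x : joint x -> x.2 != 0 ->
  [/\ x.1.1 != 0, x.1.2 != 0 & joint (x.1.1^-1, x.1.2^-1, x.2^-1)].
Proof.
move=> [e [e1 e2 e3]] x0.
have eV : rval chi (RInv e) = Some x.2^-1 by rewrite /= e3 (negPf x0).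
have [f] := chi_iota eV; have [g] := chi_phi eV; rewrite /= e1 e2.
case: eqP => // /eqP n1 _; case: eqP => // /eqP n2 _; split=> //.
by exists (RInv e); rewrite /= e1 e2 e3 (negPf x0) (negPf n1) (negPf n2).
Qed.

Lemma joint_inv1 x : joint x -> x.2 = 1 ->
  exists y, [/\ joint y, x * y = 1 & y * x = 1].
Proof.
move=> jx x1; have [|n1 n2 jV] := jointV jx; first by rewrite x1 oner_neq0.
exists (x.1.1^-1, x.1.2^-1, x.2^-1); split=> //.
  by rewrite [x]surjective_pairing [x.1]surjective_pairing /= x1 invr1;
     congr (_, _, _); rewrite /= ?mulr1 ?mulrV ?skF ?skD.
by rewrite [x]surjective_pairing [x.1]surjective_pairing /= x1 invr1;
     congr (_, _, _); rewrite /= ?mulr1 ?mulVr ?skF ?skD.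
Qed.

Lemma joint_mx_inverse n (N H : 'M[F * D * G]_n) : mx_in joint N -> mx_in joint H ->
  map_mx snd N *m map_mx snd H = 1%:M -> map_mx snd H *m map_mx snd N = 1%:M ->
  exists Y : 'M_n, [/\ mx_in joint Y, N *m Y = 1%:M & Y *m N = 1%:M].
Proof.
move=> jN jH NH HN.
by apply: (@lift_inverse_mod _ _ joint (@snd (F * D)%type G)) jN jH NH HN;
  [exact: joint1 | exact: jointN | exact: jointD | exact: jointM | exact: joint_inv1].
Qed.

End JointEvaluation.

Section Subspace.
Variables (K : fieldType) (n : nat) (V : 'rV[K]_n -> Prop).
Hypothesis V0 : V 0.
Hypothesis VL : forall c u v, V u -> V v -> V (c *: u + v).

Lemma subspace_sub m (N : 'M[K]_(m, n)) u : (forall k, V (row k N)) -> (u <= N)%MS -> V u.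
Proof.
move=> VN /submxP[d ->]; rewrite mulmx_sum_row.
elim/big_ind: _ => // [x y Vx Vy|k _]; first by rewrite -[x]scale1r; apply: VL.
by rewrite -[_ *: _]addr0; apply: VL.
Qed.

(** Take a matrix of maximal rank with rows in [V]: a vector of [V] outside its row space would
    raise the rank. *)
Lemma subspace_mx : exists N : 'M[K]_n, forall v, V v <-> (v <= N)%MS.
Proof.
pose P r := `[< exists N : 'M[K]_n, (forall k, V (row k N)) /\ \rank N = r >].
have P0 : exists r, P r.
  by exists 0%N; apply/asboolP; exists 0; split; [move=> k; rewrite row0 | exact: mxrank0].
have Pn r : P r -> (r <= n)%N by move=> /asboolP[N [_ <-]]; exact: rank_leq_row.
case: (ex_maxnP P0 Pn) => r /asboolP[N [VN rN]] maxr.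
exists N => v; split=> [Vv|]; last exact: subspace_sub.
apply: contraT => nv.
have VNv u : (u <= N + v)%MS -> V u.
  case/sub_addsmxP=> -[u1 u2] ->; rewrite -[u1 *m N]scale1r; apply: VL.
    by apply: (subspace_sub VN); exact: submxMl.
  have -> : u2 *m v = u2 0 0 *: v + 0 by rewrite [u2]mx11_scalar mul_scalar_mx !mxE eqxx addr0.
  exact: VL.
have /maxr : P (\rank (N + v)%MS).
  apply/asboolP; exists (N + v)%MS; split=> // k; apply: VNv; exact: row_sub.
by rewrite -rN leqNgt ltn_neqAle mxrankS ?addsmxSl // eqn_leq mxrankS ?addsmxSl // andbT
  -ltnNge rank_ltmx // /ltmx addsmxSl addsmx_sub submx_refl.
Qed.

End Subspace.

(** * Rational series in the free field *)

Section Span.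
Variables (K : fieldType) (T : algType K).
Implicit Types (xs : seq T) (x y z : T).

Fixpoint span xs x : Prop :=
  if xs is y :: ys then exists c : K, span ys (x - c *: y) else x = 0.

Lemma spanL xs c x y : span xs x -> span xs y -> span xs (c *: x + y).
Proof.
elim: xs x y => [|z xs IHxs] x y /=; first by move=> -> ->; rewrite scaler0 addr0.
move=> [d hd] [e he]; exists (c * d + e).
have -> : c *: x + y - (c * d + e) *: z = c *: (x - d *: z) + (y - e *: z).
  by rewrite scalerBr scalerA addrACA -opprD -scalerDl.
exact: IHxs.
Qed.

Lemma span0 xs : span xs 0.
Proof. by elim: xs => //= z xs IHxs; exists 0; rewrite scale0r subr0. Qed.

Lemma spanD xs x y : span xs x -> span xs y -> span xs (x + y).
Proof. by rewrite -{2}[x]scale1r; exact: spanL. Qed.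

Lemma spanZ xs c x : span xs x -> span xs (c *: x).
Proof. by move=> hx; rewrite -[_ *: _]addr0; apply: spanL => //; exact: span0. Qed.

Lemma span_mem xs x : x \in xs -> span xs x.
Proof.
elim: xs => //= z xs IHxs; rewrite inE; case: eqVneq => [<- _|_ /= /IHxs h].
  by exists 1; rewrite scale1r subrr; exact: span0.
by exists 0; rewrite scale0r subr0.
Qed.

Lemma span_ind (P : T -> Prop) xs :
  P 0 -> (forall c x y, P x -> P y -> P (c *: x + y)) -> {in xs, forall x, P x} ->
  forall x, span xs x -> P x.
Proof.
move=> P0 PL; elim: xs => [|z xs IHxs] Pxs x /=; first by move=> ->.
case=> c h; rewrite -[x](subrK (c *: z)) addrC; apply: PL.
  by apply: Pxs; exact: mem_head.
by apply: IHxs => // y yxs; apply: Pxs; rewrite inE yxs orbT.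
Qed.

Lemma span_sub xs ys x : {subset xs <= ys} -> span xs x -> span ys x.
Proof.
move=> xy; apply: span_ind => [|c y z|y /xy]; [exact: span0|exact: spanL|exact: span_mem].
Qed.

Lemma span_mulr xs x z : span xs x -> span [seq y * z | y <- xs] (x * z).
Proof.
apply: (@span_ind (fun x => span _ (x * z))) => [|c y y'|y yxs].
- by rewrite mul0r; exact: span0.
- by rewrite mulrDl -scalerAl; exact: spanL.
- by apply: span_mem; apply: map_f.
Qed.

Lemma span_coord xs x : span xs x ->
  exists c : 'rV[K]_(size xs), x = \sum_k c 0 k *: xs`_k.
Proof.
pose P x := exists c : 'rV[K]_(size xs), x = \sum_k c 0 k *: xs`_k.
apply: (@span_ind P) => [|c y z [u ->] [v ->]|y yxs].
- by exists 0; rewrite big1 // => k _; rewrite mxE scale0r.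
- exists (c *: u + v); rewrite scaler_sumr -big_split /=; apply: eq_bigr => k _.
  by rewrite !mxE scalerDl scalerA.
- have lt_y : (index y xs < size xs)%N by rewrite index_mem.
  exists (delta_mx 0 (Ordinal lt_y)); rewrite (bigD1 (Ordinal lt_y)) //= big1 ?addr0.
    by rewrite mxE !eqxx scale1r nth_index.
  by move=> k /negPf kn; rewrite mxE kn andbF scale0r.
Qed.

End Span.

Section SeriesInFreeField.
Variables (A : finType) (F : unitAlgType rat) (iota : {lrmorphism ncpoly A -> F}).

Local Notation TT := (series A * F)%type.
Definition pair_letter (a : A) : TT := (series_letter a, iota (letter a)).

(* [d a] is the left derivative of [x] by [a], on both components at once. *)
Definition derivable xs (x : TT) : Prop := exists (c : rat) (d : A -> TT),
  (forall a, span xs (d a)) /\ x = c%:A + \sum_a pair_letter a * d a.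

Lemma derivable0 xs : derivable xs 0.
Proof.
exists 0, (fun _ => 0); split=> [a|]; first exact: span0.
by rewrite scale0r add0r big1 // => a _; rewrite mulr0.
Qed.

Lemma derivableL xs c x y : derivable xs x -> derivable xs y -> derivable xs (c *: x + y).
Proof.
move=> [e [d [hd ->]]] [e' [d' [hd' ->]]].
exists (c * e + e'), (fun a => c *: d a + d' a); split=> [a|]; first exact: spanL.
rewrite scalerDr scalerA addrACA -scalerDl scaler_sumr -big_split /=; congr (_ + _).
by apply: eq_bigr => a _; rewrite mulrDr scalerAr.
Qed.

Lemma derivable_sub xs ys x : {subset xs <= ys} -> derivable xs x -> derivable ys x.
Proof.
by move=> xy [c [d [hd ->]]]; exists c, d; split=> // a; apply: span_sub (hd a).
Qed.

Definition stable xs := {in xs, forall x, derivable xs x}.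

Lemma stable_span xs x : stable xs -> span xs x -> derivable xs x.
Proof. by move=> st; apply: span_ind => //; [exact: derivable0|exact: derivableL]. Qed.

(** A finite linear representation shared by the series and the element of [F]. It transports
    relations between series to [F], whose elements have no coefficients to compare. *)
Definition recognizable (x : TT) : Prop := exists2 xs, stable xs & span xs x.

Lemma derivableM xs zs x z : derivable xs x -> derivable zs z ->
  derivable ([seq y * z | y <- xs] ++ zs) (x * z).
Proof.
move=> [c [d [hd ->]]] hz; rewrite mulrDl -scalerAl mul1r; apply: derivableL.
  by apply: derivable_sub hz => y; rewrite mem_cat orbC => ->.
exists 0, (fun a => d a * z); split=> [a|].
  by apply: span_sub (span_mulr z (hd a)) => y; rewrite mem_cat => ->.
by rewrite scale0r add0r mulr_suml; apply: eq_bigr => a _; rewrite mulrA.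
Qed.

Lemma recognizableD x y : recognizable x -> recognizable y -> recognizable (x + y).
Proof.
move=> [xs stx hx] [ys sty hy].
have sx : {subset xs <= xs ++ ys} by move=> z; rewrite mem_cat => ->.
have sy : {subset ys <= xs ++ ys} by move=> z; rewrite mem_cat orbC => ->.
exists (xs ++ ys); last by apply: spanD; [exact: span_sub hx | exact: span_sub hy].
move=> z; rewrite mem_cat => /orP[/stx|/sty]; exact: derivable_sub.
Qed.

Lemma recognizableM x z : recognizable x -> recognizable z -> recognizable (x * z).
Proof.
move=> [xs stx hx] [zs stz hz].
have sz : {subset zs <= [seq y * z | y <- xs] ++ zs} by move=> y; rewrite mem_cat orbC => ->.
exists ([seq y * z | y <- xs] ++ zs); last first.
  by apply: span_sub (span_mulr z hx) => y; rewrite mem_cat => ->.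
move=> t; rewrite mem_cat => /orP[/mapP[y /stx hy ->]|/stz]; last exact: derivable_sub.
by apply: derivableM => //; exact: stable_span.
Qed.

Lemma recognizable_scalar c : recognizable c%:A.
Proof.
exists [:: 1]; last by apply: spanZ; apply: span_mem; exact: mem_head.
move=> x; rewrite inE => /eqP ->; exists 1, (fun _ => 0); split=> [a|]; first exact: span0.
by rewrite scale1r big1 ?addr0 // => a _; rewrite mulr0.
Qed.

Lemma recognizable_letter a : recognizable (pair_letter a).
Proof.
exists [:: 1; pair_letter a]; last by apply: span_mem; rewrite !inE eqxx orbT.
move=> x; rewrite !inE => /orP[] /eqP ->.
  exists 1, (fun _ => 0); split=> [b|]; first exact: span0.
  by rewrite scale1r big1 ?addr0 // => b _; rewrite mulr0.
exists 0, (fun b => (b == a)%:R%:A); split=> [b|].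
  by apply: spanZ; apply: span_mem; exact: mem_head.
rewrite scale0r add0r (bigD1 a) //= eqxx scale1r mulr1 big1 ?addr0 // => b /negPf ->.
by rewrite scale0r mulr0.
Qed.

Lemma derivable_coef0 (c : rat) (d : A -> TT) :
  (c%:A + \sum_a pair_letter a * d a).1 [::] = c.
Proof.
have -> : (c%:A + \sum_a pair_letter a * d a).1 = c%:A + \sum_a series_letter a * (d a).1.
  by rewrite /= raddf_sum.
rewrite seriesDE seriesZE series1E mulr1 series_sumE big1 ?addr0 // => a _.
exact: series_letterM_nil.
Qed.

(** As [x] has no constant term, the derivatives of [s] are those of [x] times [s]; so a stable
    family for [x], multiplied by [s] and completed by [s], is stable. *)
Lemma recognizable_star x s : recognizable x -> x.1 [::] = 0 -> s = 1 + x * s ->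
  recognizable s.
Proof.
move=> [xs stx hx] x0 sE; pose ss := [seq y * s | y <- xs] ++ [:: s].
have sub : {subset [seq y * s | y <- xs] <= ss} by move=> y; rewrite mem_cat => ->.
have hs : derivable ss s.
  have [c [d [hd xE]]] := stable_span stx hx.
  have c0 : c = 0 by move: x0; rewrite xE derivable_coef0.
  exists 1, (fun a => d a * s); split=> [a|].
    exact: span_sub (span_mulr s (hd a)).
  rewrite scale1r {1}sE xE c0 scale0r add0r mulr_suml; congr (_ + _).
  by apply: eq_bigr => a _; rewrite mulrA.
exists ss; last by apply: span_mem; rewrite mem_cat mem_seq1 eqxx orbT.
move=> t; rewrite mem_cat mem_seq1 => /orP[/mapP[y /stx hy ->]|/eqP -> //].
case: hy => c [d [hd ->]]; rewrite mulrDl -scalerAl mul1r; apply: derivableL => //.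
exists 0, (fun a => d a * s); split=> [a|]; first exact: span_sub (span_mulr s (hd a)).
by rewrite scale0r add0r mulr_suml; apply: eq_bigr => a _; rewrite mulrA.
Qed.

Hypothesis hF : is_free_field iota.

Let skF : skew_field F. Proof. by case: hF. Qed.
Let chi : {lrmorphism ncpoly A -> rat^o} := @letter_eval A (fun _ => 0).
Let skQ : skew_field rat^o. Proof. by move=> x; rewrite unitfE. Qed.
Let chi_iota e v : rval chi e = Some v -> exists f, rval iota e = Some f.
Proof. exact: (@free_field_rval A (ncpoly A) F iota idfun rat^o chi hF skQ). Qed.

(** With all letters at 0, well-formedness makes every inverted 1 - T equal to 1. Through the
    universal property, no star inverts 0 in [F] either. *)
Lemma sexp_coef0 e : sexp_wf e -> rval chi (rexp_of_sexp e) = Some (sexp_series e [::] : rat^o).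
Proof.
elim: e => [c|a|e1 IH1 e2 IH2|e1 IH1 e2 IH2|e IHe] /=.
- by move=> _; congr Some; rewrite linearZ rmorph1.
- by rewrite letter_evalE.
- by case/andP=> /IH1 -> /IH2 ->.
- by case/andP=> /IH1 -> /IH2 ->; rewrite series_mul_nil.
- case/andP=> /IHe -> /eqP ->; rewrite mulr0 addr0 rmorph1 oner_eq0 invr1.
  by rewrite /series_star big_ord1.
Qed.

Lemma sexp_rval e : sexp_wf e -> exists f, rval iota (rexp_of_sexp e) = Some f.
Proof. by move/sexp_coef0/chi_iota. Qed.

Definition rational_pair (x : TT) : Prop := exists e : sexp A,
  [/\ sexp_wf e, sexp_series e = x.1 & rval iota (rexp_of_sexp e) = Some x.2].

Lemma rational_pairD x y : rational_pair x -> rational_pair y -> rational_pair (x + y).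
Proof.
move=> [e [e1 e2 e3]] [e' [e1' e2' e3']]; exists (SAdd e e') => /=.
by rewrite e1 e1' e3 e3'; split=> //; rewrite e2 e2'.
Qed.

Lemma rational_pairM x y : rational_pair x -> rational_pair y -> rational_pair (x * y).
Proof.
move=> [e [e1 e2 e3]] [e' [e1' e2' e3']]; exists (SMul e e') => /=.
by rewrite e1 e1' e3 e3'; split=> //; rewrite e2 e2'.
Qed.

Lemma rational_pair_scalar c : rational_pair c%:A.
Proof. by exists (SScalar A c); split=> //=; rewrite linearZ /= rmorph1. Qed.

Lemma rational_pair1 : rational_pair 1.
Proof. by have := rational_pair_scalar 1; rewrite scale1r. Qed.

Lemma rational_pair_letter a : rational_pair (pair_letter a).
Proof. by exists (SLetter a). Qed.

Lemma rational_pairN x : rational_pair x -> rational_pair (- x).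
Proof.
by move=> hx; rewrite -scaleN1r -mulr_algl; apply: rational_pairM => //;
  exact: rational_pair_scalar.
Qed.

(** The inverse is the star of 1 - x, whose constant term is 0. *)
Lemma rational_pairV x : rational_pair x -> x.1 [::] = 1 ->
  exists y, [/\ rational_pair y, x * y = 1 & y * x = 1].
Proof.
move=> hx x0; have [e [e1 e2 e3]] : rational_pair (1 - x).
  by apply: rational_pairD; [exact: rational_pair1 | exact: rational_pairN].
have c0 : (1 - x.1) [::] = 0 by rewrite seriesDE seriesNE x0 series1E subrr.
have wf : sexp_wf (SStar e) by rewrite /= e1 e2 /= c0 eqxx.
have [f] := sexp_rval wf; rewrite /= e3 /=.
have -> : iota 1 + iota (-1) * (1 - x.2) = x.2 by rewrite rmorphN1 rmorph1 mulN1r subKr.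
case: eqP => // /eqP x20 [fE].
have [s1 s2] := series_starP c0; rewrite subKr in s1 s2.
exists (series_star (1 - x.1), x.2^-1); split.
- exists (SStar e); split=> //=; first by rewrite e2.
  rewrite e3 /= rmorphN1 rmorph1 mulN1r subKr (negPf x20) //.
- by rewrite [x]surjective_pairing; congr (_, _); rewrite //= mulrV // skF.
- by rewrite [x]surjective_pairing; congr (_, _); rewrite //= mulVr // skF.
Qed.

Lemma rational_pair_recognizable x : rational_pair x -> recognizable x.
Proof.
case=> e [wf e2 e3]; rewrite [x]surjective_pairing -e2.
elim: e x.2 wf e3 {e2} => [c|a|e1 IH1 e2 IH2|e1 IH1 e2 IH2|e IHe] f /=.
- move=> _ [<-]; have := recognizable_scalar c; congr recognizable; congr (_, _).
  by rewrite linearZ /= rmorph1.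
- by move=> _ [<-]; exact: recognizable_letter.
- case/andP=> w1 w2; have [f1 E1] := sexp_rval w1; have [f2 E2] := sexp_rval w2.
  rewrite E1 E2 => -[<-].
  exact: recognizableD (IH1 _ w1 E1) (IH2 _ w2 E2).
- case/andP=> w1 w2; have [f1 E1] := sexp_rval w1; have [f2 E2] := sexp_rval w2.
  rewrite E1 E2 => -[<-].
  exact: recognizableM (IH1 _ w1 E1) (IH2 _ w2 E2).
- case/andP=> w1 /eqP c0; have [f1 E1] := sexp_rval w1; rewrite E1.
  rewrite rmorphN1 rmorph1 mulN1r; case: eqP => // /eqP f10 [<-].
  apply: recognizable_star (IHe _ w1 E1) _ _ => //.
  have [s1 _] := series_starP c0; congr (_, _).
    by move/eqP: s1; rewrite mulrBl mul1r subr_eq => /eqP.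
  have : (1 - f1) / (1 - f1) = 1 by rewrite mulrV // skF.
  by move/eqP; rewrite mulrBl mul1r subr_eq => /eqP.
Qed.

Lemma derivable_cons (c : rat) (d : A -> TT) b w :
  (c%:A + \sum_a pair_letter a * d a).1 (b :: w) = (d b).1 w.
Proof.
have -> : (c%:A + \sum_a pair_letter a * d a).1 = c%:A + \sum_a series_letter a * (d a).1.
  by rewrite /= raddf_sum.
rewrite seriesDE seriesZE series1E mulr0 add0r series_sumE (bigD1 b) //=.
rewrite series_letterM_cons eqxx mul1r big1 ?addr0 // => a /negPf ab.
by rewrite series_letterM_cons ab mul0r.
Qed.

Lemma nilpotent_system n (u : 'I_n -> A -> 'rV[rat]_n) (g : 'I_n -> F) :
  (forall k, g k = \sum_a iota (letter a) * \sum_l u k a 0 l *: g l) -> forall k, g k = 0.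
Proof.
move=> gE.
pose M : 'M[ncpoly A]_n := \matrix_(k, l) \sum_a u k a 0 l *: letter a.
(* 1 - M is the identity when the letters vanish, so its inverse over [F] can be lifted; the second
   slot of the triples merely repeats [chi]. *)
pose N := map_mx (joint_eta iota chi chi) (1%:M - M).
have jN : mx_in (joint iota chi chi) N by move=> k l; rewrite mxE; exact: joint_poly.
have sN : map_mx snd N = 1%:M.
  apply/matrixP=> k l; rewrite !mxE /= rmorphB rmorphMn rmorph1 rmorph_sum.
  rewrite [X in _ - X]big1 ?subr0 // => a _.
  by rewrite /= linearZ /= letter_evalE scaler0.
have chi_chi e v : rval chi e = Some v -> exists f, rval chi e = Some f by exists v.
have j1 : mx_in (joint iota chi chi) (1%:M : 'M_n).
  by apply: mx_in1; [exact: joint1 | exact: jointN | exact: jointD].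
have [||Y [_ _ YN]] := joint_mx_inverse skF skQ chi_chi chi_iota jN j1.
- by rewrite sN map_mx1 mulmx1.
- by rewrite sN map_mx1 mulmx1.
pose gv : 'cV[F]_n := \col_k g k.
have Ng : map_mx (fst \o fst) N *m gv = 0.
  have -> : map_mx (fst \o fst) N = 1%:M - map_mx iota M.
    by apply/matrixP=> k l; rewrite !mxE /= rmorphB rmorphMn rmorph1.
  rewrite mulmxBl mul1mx; apply/eqP; rewrite subr_eq0; apply/eqP/colP=> k.
  rewrite !mxE gE; under [RHS]eq_bigr do rewrite !mxE rmorph_sum mulr_suml.
  rewrite exchange_big /=; apply: eq_bigr => a _; rewrite mulr_sumr; apply: eq_bigr => l _.
  by rewrite linearZ /= -scalerAl scalerAr.
have YF : map_mx (fst \o fst) Y *m map_mx (fst \o fst) N = 1%:M.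
  by rewrite -map_mxM YN map_mx1.
have g0 : gv = 0 by rewrite -[gv]mul1mx -YF -mulmxA Ng mulmx0.
by move=> k; have := congr1 (fun Z : 'cV_n => Z k 0) g0; rewrite /= !mxE.
Qed.

(* The coordinate vectors of the zero series form a space stable under the letter
   matrices, so the second components of a basis of it solve a homogeneous linear
   system [g = N g], where [1 - N] is invertible because it is [1] at [a = 0]. *)
Lemma recognizable_eq0 x : recognizable x -> x.1 = 0 -> x.2 = 0.
Proof.
move=> [xs stx /span_coord[c xE]] x0; set n := size xs in c xE.
pose Y (v : 'rV[rat]_n) : TT := \sum_k v 0 k *: xs`_k.
have YL d u v : Y (d *: u + v) = d *: Y u + Y v.
  rewrite scaler_sumr -big_split /=; apply: eq_bigr => k _.
  by rewrite !mxE scalerDl scalerA.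
have Y0 : Y 0 = 0 by rewrite /Y big1 // => k _; rewrite mxE scale0r.
have Ysum I (r : seq I) (f : I -> rat) (v : I -> 'rV_n) :
    Y (\sum_(i <- r) f i *: v i) = \sum_(i <- r) f i *: Y (v i).
  by elim: r => [|i r IHr]; rewrite ?big_nil // !big_cons YL IHr.
have /choice[gm gmE] : forall k : 'I_n, exists gm : rat * (A -> 'rV[rat]_n),
    xs`_k = gm.1%:A + \sum_a pair_letter a * Y (gm.2 a).
  move=> k; have [g [d [hd ->]]] : derivable xs xs`_k by apply: stx; apply: mem_nth.
  have /choice[m mE] : forall a, exists m : 'rV_n, d a = Y m by move=> a; exact: span_coord.
  by exists (g, m); congr (_ + _); apply: eq_bigr => a _; rewrite mE.
pose act (v : 'rV[rat]_n) a := \sum_k v 0 k *: (gm k).2 a.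
have Yact v : Y v = (\sum_k v 0 k * (gm k).1)%:A + \sum_a pair_letter a * Y (act v a).
  rewrite {1}/Y; under eq_bigr do rewrite gmE scalerDr scalerA.
  rewrite big_split /= -scaler_suml; congr (_ + _).
  under eq_bigr do rewrite scaler_sumr.
  rewrite exchange_big /=; apply: eq_bigr => a _; rewrite /act Ysum mulr_sumr.
  by apply: eq_bigr => k _; rewrite scalerAr.
pose V v := (Y v).1 = 0.
have V0 : V 0 by rewrite /V Y0.
have VL d u v : V u -> V v -> V (d *: u + v).
  by rewrite /V YL /= => -> ->; rewrite scaler0 addr0.
have [N NP] := subspace_mx V0 VL.
have Vc v : V v -> \sum_k v 0 k * (gm k).1 = 0.
  by move=> Vv; have := congr1 (fun S : series A => S [::]) Vv; rewrite Yact derivable_coef0.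
(* The coefficient of [Y v] at [a :: w] is that of [Y (act v a)] at [w]. *)
have Va v a : V v -> V (act v a).
  move=> Vv; apply/seriesP => w; have := congr1 (fun S : series A => S (a :: w)) Vv.
  by rewrite Yact derivable_cons.
have VN k : V (row k N) by apply/NP; exact: row_sub.
have YN u : Y (u *m N) = \sum_k u 0 k *: Y (row k N) by rewrite mulmx_sum_row Ysum.
have /choice[u uE] : forall k, exists u : A -> 'rV[rat]_n, forall a, act (row k N) a = u a *m N.
  move=> k; have /choice[u uE] : forall a, exists u, act (row k N) a = u *m N.
    by move=> a; apply/submxP/NP/Va.
  by exists u.
have g0 : forall k, (Y (row k N)).2 = 0.
  apply: (@nilpotent_system _ u) => k; rewrite [in LHS]Yact Vc // scale0r add0r raddf_sum.
  by apply: eq_bigr => a _; rewrite uE YN /= raddf_sum.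
have /submxP[d cE] : (c <= N)%MS by apply/NP; rewrite /V /Y -xE.
by rewrite xE -/(Y c) cE YN raddf_sum big1 // => k _; rewrite /= g0 scaler0.
Qed.

(** Whatever value [xget] selects, its difference with [x.2] is the second component of a
    recognizable pair with zero series, hence 0. *)
Lemma series_embed_eq x : rational_pair x -> series_embed iota x.1 = x.2.
Proof.
move=> hx; rewrite /series_embed.
set P := [set f | _]%classic.
have Px : P x.2 by case: hx => e [e1 e2 e3]; exists e; split=> // w; rewrite e2.
case: xgetP => [f _ [e [e1 e2 e3]]|/(_ x.2)//].
have hf : rational_pair (x.1, f) by exists e; split=> //; exact/seriesP.
have := rational_pair_recognizable (rational_pairD hf (rational_pairN hx)).
move/recognizable_eq0; rewrite /= subrr => /(_ erefl) /eqP.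
by rewrite subr_eq0 => /eqP.
Qed.

End SeriesInFreeField.

(** * Maximal columns *)

Section MaximalColumns.
Variables (A : finType) (n : nat) (mu : seq A -> 'M[rat]_n).
Hypothesis hmu : unambiguous_automaton mu.
Hypothesis hcomplete : complete_automaton mu.
Hypothesis htransitive : transitive_automaton mu.
Implicit Types (u v w x : seq A) (l c : 'cV[rat]_n).

Lemma mu_nil : mu [::] = 1%:M. Proof. by case: hmu. Qed.
Lemma mu_cat u v : mu (u ++ v) = mu u *m mu v. Proof. by case: hmu. Qed.
Lemma mu_cons a w : mu (a :: w) = mu [:: a] *m mu w. Proof. exact: (mu_cat [:: a]). Qed.
Lemma mu_01 w i j : mu w i j = 0 \/ mu w i j = 1.
Proof.
by case: hmu => _ _ /(_ w i j); rewrite !inE => /orP[] /eqP; [left | right].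
Qed.
Lemma mu_ge0 w i j : 0 <= mu w i j.
Proof. by case: (mu_01 w i j) => ->. Qed.
Lemma mu_neq0 w i j : mu w i j != 0 -> mu w i j = 1.
Proof. by case: (mu_01 w i j) => ->; rewrite ?eqxx. Qed.

Lemma vertex_exists : exists i : 'I_n, true.
Proof.
case: (pickP (fun _ : 'I_n => true)) => [i|none]; first by exists i.
by have /eqP[] := hcomplete [::]; apply/matrixP=> i; have := none i.
Qed.

Lemma column_mul w c : is_column mu c -> is_column mu (mu w *m c).
Proof. by move=> [u [j ->]]; exists (w ++ u), j; rewrite mu_cat !colE mulmxA. Qed.

Lemma column_01 c i : is_column mu c -> c i 0 = 0 \/ c i 0 = 1.
Proof. by move=> [u [j ->]]; rewrite mxE; exact: mu_01. Qed.

Lemma column_ge0 c i : is_column mu c -> 0 <= c i 0.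
Proof. by move=> /(column_01 i)[] ->. Qed.

Lemma column_neq0 c i : is_column mu c -> c i 0 != 0 -> c i 0 = 1.
Proof. by move=> /(column_01 i)[] ->; rewrite ?eqxx. Qed.

Lemma maximal_columnP l c : maximal_column mu l -> is_column mu c ->
  (forall i, l i 0 <= c i 0) -> c = l.
Proof.
move=> [cl maxl] cc le_lc; apply: maxl => //; apply/fintype.subsetP=> i; rewrite !inE => li.
apply: contraNneq li => ci; have := le_lc i; rewrite ci => l0.
by apply/eqP/le_anti; rewrite l0 column_ge0.
Qed.

(** The entry [c j 0], which is 1, already contributes column [j] of [mu u]; the other contributions
    are nonnegative and the product is a column, so maximality excludes anything more. *)
Lemma maximal_absorb u j c : maximal_column mu (col j (mu u)) -> is_column mu c ->
  c j 0 != 0 -> mu u *m c = col j (mu u).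
Proof.
move=> maxl cc cj; apply: maximal_columnP => //; first exact: column_mul.
move=> i; rewrite !mxE (bigD1 j) //= (column_neq0 cc cj) mulr1 lerDl.
by apply: sumr_ge0 => k _; rewrite mulr_ge0 ?mu_ge0 ?column_ge0.
Qed.

Lemma column_mul_neq0 x j p c : is_column mu c -> c p 0 != 0 -> mu x j p != 0 ->
  (mu x *m c) j 0 != 0.
Proof.
move=> cc cp xp; rewrite gt_eqF // mxE (bigD1 p) //= (mu_neq0 xp) (column_neq0 cc cp) mulr1.
apply: lt_le_trans (ltr01) _; rewrite lerDl.
by apply: sumr_ge0 => k _; rewrite mulr_ge0 ?mu_ge0 ?column_ge0.
Qed.

Lemma columnP w j : is_column mu (col j (mu w)). Proof. by exists w, j. Qed.

(* Otherwise, left multiplication by suitable words would keep decreasing the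
   number of nonzero columns, down to the zero matrix. *)
Lemma maximal_column_not_killed l v : maximal_column mu l -> mu v *m l != 0.
Proof.
move=> maxl; apply/eqP=> vl0; have [[u [j lE]] _] := maxl.
pose nz w := [set q | col q (mu w) != 0].
suff no N w : (#|nz w| < N)%N -> False by apply: (no #|nz [::]|.+1 [::]).
elim: N w => // N IHN w; rewrite ltnS => wN.
have [p [q wpq]] : exists p q, mu w p q != 0.
  have := hcomplete w; case: (pickP (fun pq => mu w pq.1 pq.2 != 0)) => [[p q] ? _|none].
    by exists p, q.
  by case/eqP; apply/matrixP=> p q; rewrite mxE; have /negbFE/eqP := none (p, q).
have [x xjp] := htransitive j p.
(* Zero columns of [mu w] stay zero, and column [q] is killed: [x] makes its entry at [j] nonzero,
   [u] turns it into [l], and [v] sends [l] to 0. *)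
apply: (IHN (v ++ u ++ x ++ w)); apply: leq_trans wN; apply/proper_card/properP.
have qE : col q (mu (v ++ u ++ x ++ w)) = 0.
  have -> : col q (mu (v ++ u ++ x ++ w)) = mu v *m (mu u *m (mu x *m col q (mu w))).
    by rewrite !colE !mu_cat !mulmxA.
  rewrite (@maximal_absorb u j) -?lE //; first exact/column_mul/columnP.
  by apply: column_mul_neq0 xjp; [exact: columnP | rewrite mxE].
split.
  apply/fintype.subsetP=> k; rewrite !inE; apply: contraNneq => wk0.
  have -> : v ++ u ++ x ++ w = (v ++ u ++ x) ++ w by rewrite !catA.
  by rewrite mu_cat colE -mulmxA -colE wk0 mulmx0.
exists q; rewrite !inE ?qE ?eqxx //.
by apply: contraNneq wpq => /(congr1 (fun Z : 'cV_n => Z p 0)); rewrite /= !mxE => ->.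
Qed.

(** Let a column [c] exceed [mu v *m l], say at [i]. A word [u ++ x] sends both [c] and the unit
    column of [i] to [l]. Since [c] dominates [mu v *m l] plus that unit column, the word sends
    [mu v *m l] to 0, contradicting [maximal_column_not_killed]. *)
Lemma maximal_column_mul v l : maximal_column mu l -> maximal_column mu (mu v *m l).
Proof.
move=> maxl; have cl : is_column mu l by case: maxl.
have ccl := column_mul v cl.
split=> // c cc sub; apply/eqP/contraT=> neq.
have [i ci vli] : exists2 i, c i 0 != 0 & (mu v *m l) i 0 = 0.
  case: (pickP (fun i => (c i 0 != 0) && ((mu v *m l) i 0 == 0))) => [i /andP[? /eqP]|none].
    by exists i.
  case/eqP: neq; apply/colP=> i; have [c0|c0] := eqVneq (c i 0) 0.
    have := contraNN (fintype.subsetP sub i); rewrite !inE negbK c0 => /(_ (eqxx _)).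
    by rewrite negbK => /eqP ->.
  have := none i; rewrite c0 => /negbT h.
  by rewrite (column_neq0 cc c0) (column_neq0 ccl h).
have [[u [j lE]] _] := maxl; have [x xji] := htransitive j i.
have Ec : mu u *m (mu x *m c) = l.
  rewrite lE; apply: maximal_absorb; rewrite -?lE //; first exact: column_mul.
  exact: column_mul_neq0 xji.
have Ei : mu u *m (mu x *m delta_mx i 0) = l.
  rewrite lE; apply: maximal_absorb; rewrite -?lE -?colE //; first exact: columnP.
  by rewrite mxE.
apply: contraNT (maximal_column_not_killed (u ++ x ++ v) maxl) => _.
have -> : mu (u ++ x ++ v) *m l = mu u *m (mu x *m (mu v *m l)) by rewrite !mu_cat !mulmxA.
rewrite mulmxA -mu_cat; apply/eqP/colP=> k; rewrite [RHS]mxE; apply/le_anti/andP; split;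
  last first.
  exact/column_ge0/column_mul.
have : (mu (u ++ x) *m (c - delta_mx i 0 - mu v *m l)) k 0 >= 0.
  rewrite mxE; apply: sumr_ge0 => p _; apply: mulr_ge0; first exact: mu_ge0.
  rewrite !mxBE [delta_mx _ _ _ _]mxE eqxx andbT; have [->|pi] := eqVneq p i.
    by rewrite vli (column_neq0 cc ci) subr0 subrr.
  rewrite subr0 subr_ge0; case: (column_01 p ccl) => vlp; rewrite vlp.
    exact: column_ge0.
  by rewrite (column_neq0 cc) //; have /fintype.subsetP/(_ p) := sub; rewrite !inE vlp; apply.
rewrite !mulmxBr mu_cat -!mulmxA Ec Ei subrr sub0r [X in 0 <= X]mxE oppr_ge0.
by rewrite !mulmxA -mu_cat.
Qed.

Lemma maximal_column_neq0 l : maximal_column mu l -> exists i, l i 0 != 0.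
Proof.
move=> maxl; case: (pickP (fun i => l i 0 != 0)) => [i|none]; first by exists i.
have := maximal_column_not_killed [::] maxl; rewrite mu_nil mul1mx => /eqP[].
by apply/colP=> i; have /negbFE/eqP -> := none i; rewrite mxE.
Qed.

Lemma maximal_column_reach l l0 : maximal_column mu l -> maximal_column mu l0 ->
  exists w, mu w *m l = l0.
Proof.
move=> maxl maxl0; have [i li] := maximal_column_neq0 maxl.
have [[u [k l0E]] _] := maxl0; have [x xki] := htransitive k i.
have cl : is_column mu l by case: maxl.
exists (u ++ x); rewrite mu_cat -mulmxA l0E; apply: maximal_absorb; rewrite -?l0E //.
  exact: column_mul.
exact: column_mul_neq0 xki.
Qed.

Lemma column_of_set c : is_column mu c -> c = \col_i (i \in col_set c)%:R.
Proof.
by move=> cc; apply/colP=> i; rewrite !mxE inE; case: (column_01 i cc) => ->.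
Qed.

Lemma maximal_column_exists : exists l, maximal_column mu l.
Proof.
have [i _] := vertex_exists.
pose P (s : {set 'I_n}) := `[< is_column mu (\col_i (i \in s)%:R) >].
have P0 : P (col_set (col i (mu [::]))).
  by apply/asboolP; rewrite -column_of_set; exact: columnP.
case: (arg_maxnP (fun s : {set 'I_n} => #|s|) P0) => s /asboolP cs maxs.
exists (\col_i (i \in s)%:R); split=> // l' cl' sub.
have ss : col_set (\col_i (i \in s)%:R : 'cV[rat]_n) = s.
  by apply/finset.setP=> k; rewrite inE mxE pnatr_eq0 eqb0 negbK.
rewrite ss in sub; rewrite [l']column_of_set //; suff -> : col_set l' = s by [].
apply/eqP; rewrite eq_sym eqEcard sub; apply: maxs.
by apply/asboolP; rewrite -column_of_set.
Qed.

(** Maximal columns are indexed by their supports. Words act on them from the left, last letter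
    first, whence [foldr]. *)
Lemma maximal_columns_action : exists (m : nat) (L : 'M[rat]_(n, m))
    (act : A -> 'I_m -> 'I_m),
  [/\ (0 < m)%N /\ (forall l, maximal_column mu l <-> exists k, l = col k L),
      forall a k, mu [:: a] *m col k L = col (act a k) L
    & forall k k0, exists w, foldr act k w = k0].
Proof.
pose cv (s : {set 'I_n}) : 'cV[rat]_n := \col_i (i \in s)%:R.
pose Max := [set s | `[< maximal_column mu (cv s) >]].
pose L : 'M[rat]_(n, #|Max|) := \matrix_(i < n, k < #|Max|) (i \in (enum_val k : {set
  'I_n}))%:R.
have LE k : col k L = cv (enum_val k) by apply/colP=> i; rewrite !mxE.
have maxL l : maximal_column mu l <-> exists k, l = col k L.
  split=> [maxl|[k ->]]; last first.
    by rewrite LE; have := enum_valP k; rewrite inE => /asboolP.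
  have lE : l = cv (col_set l) by apply: column_of_set; case: maxl.
  have ml : col_set l \in Max by rewrite inE; apply/asboolP; rewrite -lE.
  by exists (enum_rank_in ml (col_set l)); rewrite LE enum_rankK_in.
have injL : injective (fun k => col k L).
  move=> k k'; rewrite /= !LE => e; apply: enum_val_inj; apply/finset.setP=> i.
  have /eqP := congr1 (fun Z : 'cV_n => Z i 0) e.
  by rewrite /= !mxE eqr_nat; case: (i \in _); case: (i \in _).
have /choice[act actE] : forall a, exists f, forall k, mu [:: a] *m col k L = col (f k) L.
  move=> a; have /choice[f fE] : forall k, exists k', mu [:: a] *m col k L = col k' L.
    by move=> k; apply/maxL/maximal_column_mul/maxL; exists k.
  by exists f.
exists #|Max|, L, act; split=> //.
  split=> //; have [l /maxL[k _]] := maximal_column_exists.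
  exact: leq_ltn_trans (leq0n k) (ltn_ord k).
move=> k k0; have [||w wE] := @maximal_column_reach (col k L) (col k0 L).
- by apply/maxL; exists k.
- by apply/maxL; exists k0.
suff wact : col (foldr act k w) L = mu w *m col k L by exists w; apply: injL; rewrite /= wact.
elim: w {wE} => [|a w IHw] /=.
  by rewrite mu_nil mul1mx.
by rewrite -actE IHw mulmxA -mu_cat.
Qed.

End MaximalColumns.

(** * Path and code series of an automaton *)

Section PathSeries.
Variables (A : finType) (n : nat) (mu : seq A -> 'M[rat]_n).
Hypothesis hmu : unambiguous_automaton mu.

Definition series_mx : 'M[series A]_n :=
  \matrix_(k, l) \sum_a mu [:: a] k l *: series_letter a.

Lemma series_mx_nil (v : 'cV[series A]_n) k : (series_mx *m v) k 0 [::] = 0.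
Proof.
rewrite mxE series_sumE big1 // => l _; rewrite mxE mulr_suml series_sumE big1 // => a _.
by rewrite -scalerAl seriesZE series_letterM_nil mulr0.
Qed.

Lemma series_mx_cons (v : 'cV[series A]_n) k a w :
  (series_mx *m v) k 0 (a :: w) = \sum_l mu [:: a] k l * v l 0 w.
Proof.
rewrite mxE series_sumE; apply: eq_bigr => l _; rewrite mxE mulr_suml series_sumE.
rewrite (bigD1 a) //= big1 => [|b /negPf ba].
  by rewrite -scalerAl seriesZE series_letterM_cons eqxx mul1r addr0.
by rewrite -scalerAl seriesZE series_letterM_cons ba mul0r mulr0.
Qed.

(** [path_series] with a free starting vertex [k], so that reading one letter gives a linear system;
    [k = i] is allowed, only later visits to [i] being excluded. *)
Definition avoiding_paths (i k : 'I_n) (w : seq A) : rat :=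
  #|[set vs : (size w).-tuple 'I_n | is_path mu k w vs && (i \notin vs)]|%:R.

Lemma avoiding_paths_nil i k : avoiding_paths i k [::] = 1.
Proof.
rewrite /avoiding_paths (_ : finset _ = [set: _]%SET); first by rewrite cardsT card_tuple expn0.
by apply/finset.setP=> vs; rewrite !inE tuple0.
Qed.

Lemma avoiding_paths_cons i k a w :
  avoiding_paths i k (a :: w) = \sum_l mu [:: a] k l * ((l != i)%:R * avoiding_paths i l w).
Proof.
pose S l := [set vs : (size w).-tuple 'I_n | is_path mu l w vs && (i \notin vs)].
pose P l := (mu [:: a] k l == 1) && (l != i).
transitivity (\sum_(l | P l) #|S l|%:R : rat); last first.
  rewrite big_mkcond; apply: eq_bigr => l _; rewrite /P /avoiding_paths -/(S l).
  by case: (mu_01 hmu [:: a] k l) => ->; rewrite ?mul0r // eqxx mul1r; case: eqP;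
    rewrite ?mul0r ?mul1r.
rewrite -natr_sum; congr (_%:R).
transitivity #|[set lv : 'I_n * (size w).-tuple 'I_n | P lv.1 && (lv.2 \in S lv.1)]|;
  last first.
  rewrite -sum1_card (eq_bigl (fun lv => P lv.1 && (lv.2 \in S lv.1))); last by move=> lv;
    rewrite inE.
  by rewrite -(pair_big_dep P (fun l v => v \in S l) (fun _ _ => 1%N)) /=;
    apply: eq_bigr => l _; rewrite sum1_card.
(* The recurrence is the bijection that detaches the first vertex reached after [k]. *)
pose f (vs : (size w).+1.-tuple 'I_n) := (thead vs, [tuple of behead vs]).
have f_inj : injective f.
  by move=> s t [e1 e2]; rewrite [s]tuple_eta [t]tuple_eta; apply: val_inj => /=; rewrite e1 e2.
rewrite -(card_imset _ f_inj); apply: eq_card => -[l v]; rewrite !inE /=.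
apply/imsetP/idP => [[vs]|].
  case/tupleP: vs => l' v'; rewrite inE /= in_cons negb_or.
  move=> /andP[/andP[kl p] /andP[il iv]] [-> ->]; rewrite theadE /P kl eq_sym il /=.
  by rewrite (_ : [tuple of _] = v') ?p //; apply: val_inj.
move=> /andP[/andP[kl li] /andP[p iv]]; exists [tuple of l :: v].
  by rewrite inE /= kl p in_cons negb_or eq_sym li.
by congr (_, _); apply: val_inj.
Qed.

Lemma avoiding_paths_system i :
  (1%:M - series_mx *m omit _ i) *m (\col_k avoiding_paths i k) = const_mx 1 :> 'cV[series A]_n.
Proof.
rewrite mulmxBl mul1mx -mulmxA; apply/colP=> k; rewrite mxBE [const_mx _ _ _]mxE.
rewrite [X in X - _]mxE; apply/seriesP => -[|a w].
  by rewrite seriesDE seriesNE series_mx_nil avoiding_paths_nil subr0.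
rewrite seriesDE seriesNE series_mx_cons avoiding_paths_cons series1E /=.
apply/eqP; rewrite subr_eq0; apply/eqP; apply: eq_bigr => l _; rewrite omit_col mxE.
by case: (l != i); rewrite ?mul1r ?mul0r.
Qed.

Definition loop_series i : 'cV[series A]_n := \col_k (fun w => mu w k i).

Lemma loop_system i : loop_series i = delta_mx i 0 + series_mx *m loop_series i.
Proof.
apply/colP=> k; rewrite [RHS]mxE; apply/seriesP=> -[|a w]; rewrite seriesDE.
  rewrite series_mx_nil addr0 !mxE (mu_nil hmu) mxE eqxx andbT.
  by case: (k == i).
rewrite series_mx_cons !mxE eqxx andbT (mu_cons hmu) mxE.
have -> : ((k == i)%:R : series A) (a :: w) = 0 by case: (k == i).
by rewrite add0r; apply: eq_bigr => l _; rewrite mxE.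
Qed.

(** By unique decoding, a nonempty word of the submonoid has exactly one prefix in [C] whose
    remainder is in the submonoid; other nonempty words have none. *)
Lemma loop_code i (C : pred (seq A)) : is_basis (fun w => mu w i i == 1) C ->
  loop_series i i 0 = 1 + lang_series C * loop_series i i 0.
Proof.
move=> [CP C_uniq]; pose N w := mu w i i == 1.
have G w : loop_series i i 0 w = (N w)%:R.
  by rewrite mxE /N; case: (mu_01 hmu w i i) => ->.
have C0 : C [::] = false.
  apply/negbTE/negP=> C0; have := C_uniq [:: [::]] [::]; rewrite /= C0.
  by move=> /(_ isT isT erefl).
apply/seriesP=> w; rewrite seriesDE seriesME G series1E.
under eq_bigr do rewrite G /lang_series -natrM mulnb.
case: w => [|a w].
  rewrite big_ord1 /= C0 addr0; congr (_%:R); apply/eqP.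
  by rewrite /N (mu_nil hmu) mxE eqxx.
rewrite add0r; set w' := a :: w.
have split1 (k k' : 'I_(size w').+1) : C (take k w') -> N (drop k w') ->
    C (take k' w') -> N (drop k' w') -> k = k'.
  move=> Ck /CP[s Cs sE] Ck' /CP[s' Cs' sE'].
  have [e _] : take k w' :: s = take k' w' :: s'.
    by apply: C_uniq; rewrite /= ?Ck ?Ck' // -sE -sE' !cat_take_drop.
  have lek (h : 'I_(size w').+1) : (h <= size w')%N by rewrite -ltnS.
  by have := congr1 size e; rewrite (size_takel (lek k)) (size_takel (lek k')) => /val_inj.
have [Nw|nNw] := boolP (N w'); last first.
  rewrite big1 // => k _; case: andP => // -[Ck /CP[s Cs sE]].
  case/negP: nNw; apply/CP; exists (take k w' :: s); first by rewrite /= Ck.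
  by rewrite /= -sE cat_take_drop.
have [[|c s] // /andP[Cc Cs] sE] := (CP w').1 Nw.
have ks : (size c < (size w').+1)%N by rewrite sE /= size_cat ltnS leq_addr.
have tE : take (Ordinal ks) w' = c by rewrite /= [X in take _ X]sE /= take_size_cat.
have dE : drop (Ordinal ks) w' = flatten s by rewrite /= [X in drop _ X]sE /= drop_size_cat.
have Nd : N (drop (Ordinal ks) w') by apply/CP; exists s.
rewrite (bigD1 (Ordinal ks)) //= big1 ?addr0 => [|k kk].
  by move: Nd; rewrite /= -/(take _ _) => ->; rewrite [take _ _]tE Cc.
case: andP => // -[Ck Nk]; case/eqP: kk; apply: split1 => //; by rewrite tE.
Qed.

(** Both series solve g = 1 + s g in the unknown s, where g is the series of the submonoid. It has
    constant term 1, so it can be cancelled. *)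
Lemma return_series i (X : 'M[series A]_n) (C : pred (seq A)) :
  X *m (1%:M - series_mx *m omit _ i) = 1%:M ->
  is_basis (fun w => mu w i i == 1) C -> (X *m series_mx) i i = lang_series C.
Proof.
move=> XN hC; set g := loop_series i i 0; set G := loop_series i.
have NG : (1%:M - series_mx *m omit _ i) *m G = delta_mx i 0 + col i series_mx *m g%:M.
  rewrite omit_row mulmxBl mul1mx mulmxBl opprB addrCA addrC.
  rewrite {1}/G loop_system -/G addrK -mulmxA; congr (_ + _ *m _).
  by rewrite -rowE; apply/matrixP=> a b; rewrite !ord1 [LHS]mxE [RHS]mxE eqxx mulr1n.
have gE : g = 1 + (X *m series_mx) i i * g.
  have : G = X *m delta_mx i 0 + col i (X *m series_mx) *m g%:M.
    by rewrite -[LHS]mul1mx -XN -mulmxA NG mulmxDr !colE !mulmxA.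
  move=> /(congr1 (fun Z : 'cV_n => Z i 0)); rewrite /= -/g [RHS]mxE mul_scalar11 -colE !mxE.
  by rewrite (omit_inverse_coli XN) eqxx.
have g0 : (1 - g) [::] = 0.
  by rewrite seriesDE seriesNE series1E /g !mxE (mu_nil hmu) mxE eqxx subrr.
have [gs _] := series_starP g0; rewrite subKr in gs.
rewrite -[LHS]mulr1 -[RHS]mulr1 -gs !mulrA; congr (_ * _).
by apply: (addrI 1); rewrite -gE /g -loop_code.
Qed.

End PathSeries.

Lemma mx_in_omit (T : nzRingType) (E : T -> Prop) n (i : 'I_n) :
  E 1 -> (forall x, E x -> E (- x)) -> (forall x y, E x -> E y -> E (x + y)) ->
  mx_in E (omit T i).
Proof.
move=> E1 EN ED; apply: mx_in_add => //; first exact: mx_in1.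
apply: mx_in_opp => // k l; rewrite mxE; case: (_ && _) => //; exact: closed0.
Qed.

Lemma map_omit (R S : nzRingType) (f : {rmorphism R -> S}) n (i : 'I_n) :
  map_mx f (omit R i) = omit S i.
Proof. by rewrite /omit map_mxB map_mx1 map_delta_mx. Qed.

(** * Codes, paths and the derivation inside the free field *)

Section Embedding.
Variables (A : finType) (n : nat) (mu : seq A -> 'M[rat]_n).
Hypothesis hmu : unambiguous_automaton mu.
Variables (F : unitAlgType rat) (iota : {lrmorphism ncpoly A -> F}).
Hypothesis hF : is_free_field iota.
Variables (i : 'I_n) (X : 'M[F]_n).
Let M := map_mx iota (automaton_mx mu).
Hypothesis XN : X *m (1%:M - M *m omit F i) = 1%:M.

(** The matrix is inverted over series and over [F] at once, among rational pairs, since its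
    constant term is the identity; uniqueness of inverses identifies the [F] component with [X]. *)
Lemma rational_inverse : exists Y : 'M[series A]_n,
  [/\ forall k l, rational_pair iota (Y k l, X k l),
      Y *m (1%:M - series_mx mu *m omit _ i) = 1%:M
    & (1%:M - series_mx mu *m omit _ i) *m Y = 1%:M].
Proof.
pose MT : 'M[series A * F]_n := \matrix_(k, l) \sum_a mu [:: a] k l *: pair_letter iota a.
have rS : map_mx fst MT = series_mx mu.
  by apply/matrixP=> k l; rewrite !mxE raddf_sum.
have rF : map_mx snd MT = M.
  apply/matrixP=> k l; rewrite !mxE !raddf_sum; apply: eq_bigr => a _.
  by rewrite /= linearZ.
pose N := 1%:M - MT *m omit _ i.
have E1 := rational_pair1 iota; have EN := @rational_pairN _ _ iota.
have ED := @rational_pairD _ _ iota; have EM := @rational_pairM _ _ iota.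
have MTE : mx_in (rational_pair iota) MT.
  move=> k l; rewrite mxE; apply: (closed_sum E1 EN ED) => a _; rewrite -mulr_algl.
  by apply: EM; [exact: rational_pair_scalar | exact: rational_pair_letter].
have NE : mx_in (rational_pair iota) N.
  apply: mx_in_add => //; first exact: mx_in1.
  by apply: mx_in_opp => //; apply: mx_in_mul => //; exact: mx_in_omit.
pose rho : {rmorphism series A * F -> rat} := @coef0 A \o @fst (series A) F.
have rN : map_mx rho N = 1%:M.
  have M0 : map_mx rho MT = 0.
    apply/matrixP=> k l; rewrite !mxE rmorph_sum big1 // => a _.
    by rewrite /= /coef0 seriesZE mulr0.
  by rewrite map_mxB map_mxM M0 mul0mx subr0 map_mx1.
have [Y [YE NY YN]] := lift_inverse (rho := rho) E1 EN ED EM (rational_pairV hF) NE rN.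
have nS : map_mx fst N = 1%:M - series_mx mu *m omit _ i.
  by rewrite map_mxB map_mxM map_mx1 rS map_omit.
have nF : map_mx snd N = 1%:M - M *m omit _ i.
  by rewrite map_mxB map_mxM map_mx1 rF map_omit.
have XY : map_mx snd Y = X.
  have NF : (1%:M - M *m omit _ i) *m map_mx snd Y = 1%:M.
    by rewrite -nF -map_mxM NY map_mx1.
  by rewrite -[LHS]mul1mx -XN -mulmxA NF mulmx1.
exists (map_mx fst Y); split.
- by move=> k l; rewrite -XY !mxE -surjective_pairing.
- by rewrite -nS -map_mxM YN map_mx1.
- by rewrite -nS -map_mxM NY map_mx1.
Qed.

Lemma embed_return C : is_basis (fun w => mu w i i == 1) C ->
  series_embed iota (lang_series C) = (X *m M) i i.
Proof.
move=> hC; have [Y [YE YN NY]] := rational_inverse.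
rewrite -(return_series hmu YN hC).
apply: (series_embed_eq hF (x := ((Y *m series_mx mu) i i, (X *m M) i i))).
have -> : ((Y *m series_mx mu) i i, (X *m M) i i) =
    \sum_k (Y i k, X i k) * \sum_a mu [:: a] k i *: pair_letter iota a.
  rewrite [RHS]surjective_pairing !raddf_sum !mxE /=; congr (_, _).
    by apply: eq_bigr => k _; rewrite raddf_sum !mxE.
  apply: eq_bigr => k _; rewrite !mxE !raddf_sum; congr (_ * _); apply: eq_bigr => a _.
  by rewrite /= linearZ.
have E1 := rational_pair1 iota; have EN := @rational_pairN _ _ iota.
have ED := @rational_pairD _ _ iota.
apply: (closed_sum E1 EN ED) => k _; apply: rational_pairM => //.
apply: (closed_sum E1 EN ED) => a _; rewrite -mulr_algl.
by apply: rational_pairM; [exact: rational_pair_scalar | exact: rational_pair_letter].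
Qed.

Lemma embed_path : series_embed iota (path_series mu i) = \sum_k X i k.
Proof.
have [Y [YE YN NY]] := rational_inverse.
have -> : path_series mu i = \sum_k Y i k.
  have := avoiding_paths_system hmu i => /(congr1 (mulmx Y)).
  rewrite mulmxA YN mul1mx => /(congr1 (fun Z : 'cV_n => Z i 0)); rewrite /= !mxE => e.
  by rewrite [LHS]e; apply: eq_bigr => k _; rewrite mxE mulr1.
apply: (series_embed_eq hF (x := (\sum_k Y i k, \sum_k X i k))).
have -> : (\sum_k Y i k, \sum_k X i k) = \sum_k (Y i k, X i k).
  by rewrite [RHS]surjective_pairing !raddf_sum.
by apply: (closed_sum (rational_pair1 iota) (@rational_pairN _ _ iota) (@rational_pairD _ _
  iota)).
Qed.

Hypothesis NX : (1%:M - M *m omit F i) *m X = 1%:M.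
Variable lambda : F -> F.
Hypothesis hlambda : is_derivation lambda.
Hypothesis lambda_letter : forall a, lambda (iota (letter a)) = iota (letter a).

Let lambdaD x y : lambda (x + y) = lambda x + lambda y. Proof. by case: hlambda. Qed.
Let lambdaM x y : lambda (x * y) = lambda x * y + x * lambda y. Proof. by case: hlambda. Qed.

Lemma derivation0 : lambda 0 = 0.
Proof. by apply: (addrI (lambda 0)); rewrite -lambdaD !addr0. Qed.

Lemma derivationN x : lambda (- x) = - lambda x.
Proof. by apply/eqP; rewrite -addr_eq0 -lambdaD addNr derivation0. Qed.

Lemma derivation1 : lambda 1 = 0.
Proof.
have e := lambdaM 1 1; rewrite !mulr1 mul1r in e.
by apply: (addrI (lambda 1)); rewrite addr0 -e.
Qed.

Lemma derivation_sum I (r : seq I) (f : I -> F) :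
  lambda (\sum_(k <- r) f k) = \sum_(k <- r) lambda (f k).
Proof. by elim: r => [|k r IHr]; rewrite ?big_nil ?derivation0 // !big_cons lambdaD IHr. Qed.

(** Linearity over Q has to be drawn from additivity and the Leibniz rule: integers are killed, and
    [c] times its denominator is one. *)
Lemma derivation_scalar (c : rat) : lambda c%:A = 0.
Proof.
have nat0 k x : lambda (x *+ k) = lambda x *+ k.
  by elim: k => [|k IHk]; rewrite ?mulr0n ?derivation0 // !mulrS lambdaD IHk.
have int0 (z : int) : lambda z%:~R = 0.
  case: z => k; first by rewrite -pmulrn nat0 derivation1 mul0rn.
  by rewrite NegzE mulrNz derivationN -pmulrn nat0 derivation1 mul0rn oppr0.
have d0 : (denq c)%:~R != 0 :> rat by rewrite intr_eq0 denq_eq0.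
have intA (z : int) : z%:~R = (z%:~R : rat)%:A :> F by rewrite scaler_int.
have e : c%:A * (denq c)%:~R = (numq c)%:~R :> F.
  by rewrite !intA -scalerAl mul1r scalerA numqE.
have uF : (denq c)%:~R \is a @GRing.unit F.
  case: hF => skF _ _ _; apply: skF; rewrite intA.
  by rewrite scaler_eq0 negb_or oner_eq0 andbT.
apply: (mulIr uF); rewrite mul0r.
by have := int0 (numq c); rewrite -e lambdaM int0 mulr0 addr0.
Qed.

Lemma derivationZ (c : rat) x : lambda (c *: x) = c *: lambda x.
Proof. by rewrite -mulr_algl lambdaM derivation_scalar mul0r add0r mulr_algl. Qed.

Lemma derivation_mulmx m p r (B : 'M[F]_(m, p)) (C : 'M[F]_(p, r)) :
  map_mx lambda (B *m C) = map_mx lambda B *m C + B *m map_mx lambda C.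
Proof.
apply/matrixP=> k l; rewrite !mxE derivation_sum -big_split /=.
by apply: eq_bigr => h _; rewrite lambdaM !mxE.
Qed.

(** [lambda] fixes the entries of [M], so deriving X N = 1, with N = 1 - M omit(i), gives lambda(X)
    = X M omit(i) X = (X - 1) X. Hence lambda(X M) = (X - 1) X M + X M. *)
Lemma derivation_return : lambda ((X *m M) i i) = (X *m X *m M) i i.
Proof.
have dM : map_mx lambda M = M.
  apply/matrixP=> k l; rewrite !mxE rmorph_sum derivation_sum; apply: eq_bigr => a _.
  by rewrite /= linearZ derivationZ lambda_letter.
have d01 (b : bool) : lambda b%:R = 0 by case: b; rewrite ?derivation0 ?derivation1.
have d1 : map_mx lambda 1%:M = 0 :> 'M_n.
  by apply/matrixP=> k l; rewrite !mxE; exact: d01.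
have dB m p (B C : 'M[F]_(m, p)) : map_mx lambda (B - C) = map_mx lambda B - map_mx lambda C.
  by apply/matrixP=> k l; rewrite !mxE lambdaD derivationN.
have dO : map_mx lambda (omit F i) = 0.
  by rewrite dB d1 sub0r; apply/matrixP=> k l; rewrite !mxE d01 oppr0.
pose N := 1%:M - M *m omit F i; have XN' : X *m N = 1%:M by [].
have XMO : X *m M *m omit F i = X - 1%:M.
  by rewrite -XN' [X *m N]mulmxBr mulmx1 opprB addrCA subrr addr0 mulmxA.
have dX : map_mx lambda X = (X - 1%:M) *m X.
  have dN : map_mx lambda N = - (M *m omit F i).
    by rewrite dB d1 sub0r derivation_mulmx dM dO mulmx0 addr0.
  have := congr1 (map_mx lambda) XN'; rewrite derivation_mulmx d1 dN mulmxN mulmxA XMO.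
  move/eqP; rewrite subr_eq0 => /eqP /(congr1 (mulmx^~ X)).
  by rewrite -mulmxA NX mulmx1.
have := congr1 (fun Z : 'M_n => Z i i) (derivation_mulmx X M).
rewrite /= mxE => ->; rewrite dX dM mulmxBl mul1mx mulmxBl addrNK //.
Qed.

End Embedding.

(** * The Bernoulli specialization *)

Section Bernoulli.
Variables (A : choiceType) (h : A -> rat).

Definition bernoulli (p : ncpoly A) : rat := letter_eval h p.

Lemma bernoulli_additive : {morph bernoulli : x y / x - y}.
Proof. exact: letter_eval_additive. Qed.
HB.instance Definition _ :=
  GRing.isZmodMorphism.Build (ncpoly A) rat bernoulli bernoulli_additive.
Lemma bernoulli_monoid : monoid_morphism bernoulli.
Proof. exact: letter_eval_monoid. Qed.
HB.instance Definition _ :=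
  GRing.isMonoidMorphism.Build (ncpoly A) rat bernoulli bernoulli_monoid.

Lemma bernoulli_letter a : bernoulli (letter a) = h a.
Proof. exact: letter_evalE. Qed.

Lemma bernoulliZ c p : bernoulli (c *: p) = c * bernoulli p.
Proof. exact: letter_eval_scalable. Qed.

End Bernoulli.

Section ColumnAction.
Variables (A : finType) (n m : nat) (mu : seq A -> 'M[rat]_n).
Variables (L : 'M[rat]_(n, m)) (act : A -> 'I_m -> 'I_m).
Hypothesis actE : forall a k, mu [:: a] *m col k L = col (act a k) L.

(* The automaton [k |-> act a k] reads words from right to left, so it is the columns
   of its matrix that sum to 1. *)
Definition action_mx : 'M[ncpoly A]_m :=
  \matrix_(k', k) \sum_a (act a k == k')%:R *: letter a.

Lemma automaton_action :
  automaton_mx mu *m map_mx (in_alg _) L = map_mx (in_alg _) L *m action_mx.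
Proof.
apply/matrixP=> i k; rewrite !mxE.
transitivity (\sum_a L i (act a k) *: letter a).
  under eq_bigr do rewrite !mxE mulr_algr scaler_sumr.
  rewrite exchange_big /=; apply: eq_bigr => a _.
  under eq_bigr do rewrite scalerA.
  rewrite -scaler_suml; congr (_ *: _).
  have := congr1 (fun Z : 'cV_n => Z i 0) (actE a k); rewrite /= !mxE => <-.
  by apply: eq_bigr => l _; rewrite mxE mulrC.
under [RHS]eq_bigr do rewrite !mxE mulr_algl scaler_sumr.
rewrite exchange_big /=; apply: eq_bigr => a _.
rewrite (bigD1 (act a k)) //= eqxx scale1r big1 ?addr0 // => k' /negPf kk'.
by rewrite eq_sym kk' scale0r scaler0.
Qed.

Lemma action_sum : const_mx 1 *m action_mx = const_mx (\sum_a letter a) :> 'rV_m.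
Proof.
apply/rowP=> k; rewrite !mxE.
under eq_bigr do rewrite !mxE mul1r.
rewrite exchange_big /=; apply: eq_bigr => a _.
rewrite (bigD1 (act a k)) //= eqxx scale1r big1 ?addr0 // => k' /negPf kk'.
by rewrite eq_sym kk' scale0r.
Qed.

Variables (R : nzRingType) (psi : {rmorphism ncpoly A -> R}).
Hypothesis psi1 : psi (\sum_a letter a) = 1.
Let Q := map_mx psi action_mx.
Let M := map_mx psi (automaton_mx mu).
Let Lp := map_mx psi (map_mx (in_alg _) L).

Lemma action_sum1 : const_mx 1 *m Q = const_mx 1 :> 'rV_m.
Proof.
have := congr1 (map_mx psi) action_sum.
by rewrite map_mxM !map_const_mx rmorph1 psi1.
Qed.

Lemma action_fixed (k0 : 'I_m) (U : 'M[R]_m) : (1%:M - omit R k0 *m Q) *m U = 1%:M ->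
  M *m (Lp *m col k0 U) = Lp *m col k0 U.
Proof.
move=> NU; rewrite mulmxA -map_mxM automaton_action map_mxM -mulmxA.
by rewrite (stochastic_right_fixed action_sum1 NU).
Qed.

Lemma action_left_constant (k0 : 'I_m) (U : 'M[R]_m) (x : 'rV[R]_n) :
  (1%:M - omit R k0 *m Q) *m U = 1%:M -> x *m M = x ->
  forall k, (x *m Lp) 0 k = (x *m Lp) 0 k0.
Proof.
move=> NU xM; apply: (stochastic_left_unique action_sum1 NU).
by rewrite -mulmxA -map_mxM -automaton_action map_mxM mulmxA xM.
Qed.

End ColumnAction.

Section Positive.
Variables (A : finType) (n : nat) (mu : seq A -> 'M[rat]_n).
Hypothesis hmu : unambiguous_automaton mu.
Hypothesis hcomplete : complete_automaton mu.
Hypothesis htransitive : transitive_automaton mu.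
Variable h : A -> rat.
Hypothesis h_gt0 : forall a, 0 < h a.
Hypothesis h_sum : \sum_a h a = 1.

Let M := map_mx (bernoulli h) (automaton_mx mu).

Lemma bernoulli_sum : bernoulli h (\sum_a letter a) = 1.
Proof. by rewrite rmorph_sum -h_sum; apply: eq_bigr => a _; rewrite /= bernoulli_letter. Qed.

Lemma weighted_sum_ge0 (f : A -> rat) : (forall a, 0 <= f a) -> 0 <= \sum_a f a * h a.
Proof. by move=> f0; apply: sumr_ge0 => a _; rewrite mulr_ge0 // ltW. Qed.

Lemma weighted_sum_neq0 (f : A -> rat) a : (forall a, 0 <= f a) -> f a != 0 ->
  \sum_a f a * h a != 0.
Proof.
move=> f0 fa; rewrite gt_eqF // (bigD1 a) //= ltr_pwDl //.
  by rewrite mulr_gt0 // lt_neqAle eq_sym fa f0.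
by apply: sumr_ge0 => b _; rewrite mulr_ge0 // ltW.
Qed.

Lemma bernoulli_automatonE k l : M k l = \sum_a mu [:: a] k l * h a.
Proof.
by rewrite !mxE rmorph_sum; apply: eq_bigr => a _; rewrite /= bernoulliZ bernoulli_letter.
Qed.

Lemma bernoulli_automaton_ge0 k l : 0 <= M k l.
Proof. by rewrite bernoulli_automatonE; apply: weighted_sum_ge0 => a; exact: (mu_ge0 hmu). Qed.

Lemma automaton_reach i (S : pred 'I_n) : (exists k, S k) ->
  (forall k l, S k -> M k l != 0 -> S l) -> S i.
Proof.
move=> [k Sk] closedS; have [w] := htransitive k i.
elim: w k Sk => [|a w IHw] k Sk.
  by rewrite (mu_nil hmu) mxE; case: (eqVneq k i) => [<-|_]; rewrite ?eqxx.
rewrite (mu_cons hmu) mxE => nz.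
case: (pickP (fun l => mu [:: a] k l * mu w l i != 0)) => [l|none]; last first.
  by case/eqP: nz; apply: big1 => l _; have /negbFE/eqP := none l.
rewrite mulf_eq0 negb_or => /andP[kl li]; apply: (IHw l) => //; apply: (closedS k) => //.
rewrite bernoulli_automatonE; apply: weighted_sum_neq0 kl => b; exact: (mu_ge0 hmu).
Qed.

Lemma automaton_omit_inverse (y : 'cV[rat]_n) i : (forall k, 0 < y k 0) -> M *m y = y ->
  exists X : 'M[rat]_n, [/\ (1%:M - M *m omit _ i) *m X = 1%:M,
    X *m (1%:M - M *m omit _ i) = 1%:M & forall k l, 0 <= X k l].
Proof.
move=> y0 My; apply: (omit_inverse_ge0 bernoulli_automaton_ge0 y0 My) => S.
exact: automaton_reach.
Qed.

(** A zero entry of M y = y forces all its nonnegative terms to vanish, so the zero set of [y] is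
    closed under edges; strong connectivity would make a nonempty one contain every vertex. *)
Lemma fixed_vector_gt0 (y : 'cV[rat]_n) : (forall k, 0 <= y k 0) -> (exists k, y k 0 != 0) ->
  M *m y = y -> forall k, 0 < y k 0.
Proof.
move=> y0 [i yi] My k; rewrite lt_neqAle y0 andbT eq_sym; apply: contraNneq yi => yk.
apply: (@automaton_reach i (fun k => y k 0 == 0)); first by exists k; rewrite yk.
move=> {yk}k l /eqP yk Mkl.
have : \sum_l M k l * y l 0 = 0.
  by transitivity ((M *m y) k 0); [rewrite [RHS]mxE | rewrite My].
move/eqP; rewrite psumr_eq0 => [/allP/(_ l)|l' _];
  last by rewrite mulr_ge0 ?bernoulli_automaton_ge0.
by rewrite mem_index_enum mulf_eq0 (negPf Mkl) => /(_ isT).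
Qed.

Variables (m : nat) (L : 'M[rat]_(n, m)) (act : A -> 'I_m -> 'I_m).
Hypothesis actE : forall a k, mu [:: a] *m col k L = col (act a k) L.
Hypothesis L_maximal : forall k, maximal_column mu (col k L).
Hypothesis act_reach : forall k k0, exists w, foldr act k w = k0.
Let Q := map_mx (bernoulli h) (action_mx act).

Lemma bernoulli_actionE k l : Q k l = \sum_a (act a l == k)%:R * h a.
Proof.
by rewrite !mxE rmorph_sum; apply: eq_bigr => a _; rewrite /= bernoulliZ bernoulli_letter.
Qed.

(** The minimum principle is applied to the transpose of [Q], whose positive fixed column is the
    constant one. *)
Lemma action_omit_inverse k0 : exists U : 'M[rat]_m,
  [/\ (1%:M - omit _ k0 *m Q) *m U = 1%:M,
      U *m (1%:M - omit _ k0 *m Q) = 1%:M & forall k l, 0 <= U k l].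
Proof.
have tr_omit : (omit rat k0)^T = omit rat k0.
  by rewrite /omit raddfB /= trmx1 trmx_delta.
have trN : (1%:M - Q^T *m omit _ k0)^T = 1%:M - omit _ k0 *m Q.
  by rewrite raddfB /= trmx1 trmx_mul trmxK tr_omit.
have [||||X [NX XN X0]] := @omit_inverse_ge0 _ m Q^T (const_mx 1) k0.
- move=> k l; rewrite mxE bernoulli_actionE; apply: weighted_sum_ge0 => a.
  exact: ler0n.
- by move=> k; rewrite mxE ltr01.
- have := action_sum1 act bernoulli_sum => /(congr1 trmx).
  by rewrite trmx_mul trmx_const.
- move=> S [k Sk] closedS; have [w] := act_reach k k0.
  (* Edges of the transpose lead from [k] to [act a k], and [foldr] applies the last letter
     first. *)
  elim/last_ind: w k Sk => [|w a IHw] k Sk; first by move=> /= <-.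
  rewrite foldr_rcons; apply: IHw; apply: (closedS k) => //.
  rewrite mxE bernoulli_actionE; apply: (@weighted_sum_neq0 _ a) => [b|].
    exact: ler0n.
  by rewrite eqxx oner_neq0.
exists X^T; split.
- by rewrite -trN -trmx_mul XN trmx1.
- by rewrite -trN -trmx_mul NX trmx1.
- by move=> k l; rewrite mxE.
Qed.

(** The vector is nonzero because [U k0 k0] is 1 and the maximal column [col k0 L] is nonzero; a
    nonnegative nonzero fixed vector is positive. *)
Lemma action_fixed_gt0 k0 (U : 'M[rat]_m) : (1%:M - omit _ k0 *m Q) *m U = 1%:M ->
  (forall k l, 0 <= U k l) -> forall i, 0 < (L *m col k0 U) i 0.
Proof.
move=> NU U0.
have L_ge0 i k : 0 <= L i k.
  have [cl _] := L_maximal k; have := column_ge0 hmu i cl; by rewrite mxE.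
have LE : map_mx (bernoulli h) (map_mx (in_alg _) L) = L.
  by apply/matrixP=> i k; rewrite !mxE bernoulliZ rmorph1 mulr1.
have Uk0 : U k0 k0 = 1.
  have := congr1 (fun Z : 'M_m => Z k0 k0) NU.
  by rewrite /= mulmxBl mul1mx mxBE -mulmxA omit_col eqxx mul0r subr0 mxE eqxx.
apply: fixed_vector_gt0.
- by move=> i; rewrite mxE; apply: sumr_ge0 => k _; rewrite mxE mulr_ge0.
- have [i] := maximal_column_neq0 hmu hcomplete htransitive (L_maximal k0); rewrite mxE => Li.
  exists i; rewrite gt_eqF // mxE (bigD1 k0) //= ltr_pwDl //.
    by rewrite mxE Uk0 mulr1 lt_neqAle eq_sym Li L_ge0.
  by apply: sumr_ge0 => k _; rewrite mxE mulr_ge0.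
- by have := action_fixed actE bernoulli_sum NU; rewrite LE.
Qed.

End Positive.

(** * The theorem: lifting from Q to both free fields *)

Unset Implicit Arguments.

Theorem theorem2 (A : finType) (n : nat) (mu : seq A -> 'M[rat]_n)
    (hA : (0 < #|A|)%N)
    (hmu : unambiguous_automaton mu)
    (hcomplete : complete_automaton mu)
    (htransitive : transitive_automaton mu)
    (* the free field of Q<A> *)
    (F : unitAlgType rat) (iota : {lrmorphism ncpoly A -> F})
    (hF : is_free_field iota)
    (* B = Q<A> / (sum of the letters - 1), and the probabilistic free field *)
    (B : algType rat) (q : {lrmorphism ncpoly A -> B})
    (hB : is_quotient (\sum_(a : A) letter a - 1) q)
    (PF : unitAlgType rat) (kappa : {lrmorphism B -> PF})
    (hPF : is_free_field kappa)
    (lambda : F -> F) (hlambda : is_derivation lambda)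
    (hlambda_letter : forall a : A, lambda (iota (letter a)) = iota (letter a))
    (code : 'I_n -> pred (seq A))
    (hcode : forall i, is_basis (fun w => mu w i i == 1) (code i))
    (* PFt = PF(t) *)
    (PFt : unitRingType) (j : {rmorphism {poly PF} -> PFt})
    (hPFt : is_fraction_field j) :
  let C i := series_embed iota (lang_series (code i)) in
  let P i := series_embed iota (path_series mu i) in
  let pi : ncpoly A -> PF := kappa \o q in
  let Pmx := map_mx pi (automaton_mx mu) in
  exists (c p : 'I_n -> PF) (pinv : 'rV[PF]_n),
    (forall i, [/\ evaluates iota pi (C i) (c i),
                   evaluates iota pi (P i) (p i),
                   P i != 0 & evaluates iota pi (P i)^-1 (pinv 0 i)]) /\
    [/\ forall i, c i = 1,
        exists (S : 'M[PFt]_n) (N : 'M[PF]_n),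
          [/\ is_star_mx j Pmx S,
              forall k l, eval_at1 j (((1 - j 'X) *: S) k l) (N k l)
            & forall i, exists v, [/\ evaluates iota pi (lambda (C i)) v,
                                      v != 0 & N i i = v^-1]],
        pinv *m Pmx = pinv,
        \sum_(i < n) pinv 0 i = 1
      & forall l l' : 'cV[rat]_n, maximal_column mu l -> maximal_column mu l' ->
          pinv *m map_mx (in_alg PF) l = pinv *m map_mx (in_alg PF) l'].
Proof.
move=> C P pi Pmx.
have skF : skew_field F by case: hF.
have skPF : skew_field PF by case: hPF.
have skQ : skew_field (rat : unitRingType) by move=> x; rewrite unitfE.
(* Any positive weights of sum 1 would do: the sum lets the evaluation descend to [B], positivity
   feeds the minimum principle. *)
pose h (_ : A) : rat := #|A|%:R^-1.
have h_gt0 a : 0 < h a by rewrite invr_gt0 ltr0n.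
have h_sum : \sum_a h a = 1.
  by rewrite /h sumr_const -[LHS]mulr_natr mulVf // pnatr_eq0 -lt0n.
pose phi : {lrmorphism ncpoly A -> PF} := kappa \o q.
pose chi := @bernoulli A h.
have chi1 : letter_eval h (\sum_(a : A) letter a - 1) = 0.
  rewrite rmorphB rmorph1; apply/eqP; rewrite subr_eq0; apply/eqP.
  exact: bernoulli_sum.
have [chi' chi'E] := quotient_lift hB chi1.
have chi_phi e v : rval chi e = Some v -> exists f, rval phi e = Some f.
  have -> : (chi : ncpoly A -> rat) = chi' \o q by apply/funext=> p; exact/esym/chi'E.
  exact: (@free_field_rval A B PF kappa q rat^o chi' hPF skQ).
have chi_iota e v : rval chi e = Some v -> exists f, rval iota e = Some f.
  exact: (@free_field_rval A (ncpoly A) F iota idfun rat^o (letter_eval h) hF skQ).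
have psi1 : phi (\sum_a letter a) = 1.
  have /eqP : q (\sum_(a : A) letter a - 1) = 0.
    by case: hB => _ /(_ (\sum_(a : A) letter a - 1)) [_]; apply; exists [:: (1, 1)];
      rewrite big_seq1 mul1r mulr1.
  by rewrite rmorphB rmorph1 subr_eq0 /= => /eqP ->; rewrite rmorph1.
have [m [L [act [[m0 maxL] actE act_reach]]]] := maximal_columns_action hmu hcomplete
  htransitive.
have Lmax k : maximal_column mu (col k L) by apply/maxL; exists k.
pose k0 := Ordinal m0.
pose J := @joint A F PF rat iota phi chi.
pose eta := @joint_eta A F PF rat iota phi chi.
have J1 : J 1 by exact: joint1.
have JN : forall x, J x -> J (- x) by exact: jointN.
have JD : forall x y, J x -> J y -> J (x + y) by exact: jointD.
have JM : forall x y, J x -> J y -> J (x * y) by exact: jointM.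
have Jinv := joint_mx_inverse skF skPF chi_phi chi_iota.
have Jeta r s (N : 'M[ncpoly A]_(r, s)) : mx_in J (map_mx eta N).
  by move=> k l; rewrite mxE; exact: joint_poly.
pose cst r s (N : 'M[rat]_(r, s)) := map_mx eta (map_mx (in_alg (ncpoly A)) N).
have Jmul r s t (N : 'M_(r, s)) (N' : 'M_(s, t)) : mx_in J N -> mx_in J N' -> mx_in J (N *m N').
  exact: mx_in_mul.
have J1B r (N : 'M_r) : mx_in J N -> mx_in J (1%:M - N).
  by move=> JN'; apply: mx_in_add => //; [exact: mx_in1 | exact: mx_in_opp].
have Jomit r (i : 'I_r) : mx_in J (omit _ i) by exact: mx_in_omit.
have Jcst r s (N : 'M_(r, s)) : mx_in J (cst _ _ N) by exact: Jeta.
have cstQ r s (N : 'M[rat]_(r, s)) : map_mx snd (cst _ _ N) = N.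
  by apply/matrixP=> k l; rewrite !mxE /= /chi bernoulliZ rmorph1 mulr1.
pose pF : {rmorphism F * PF * rat -> F} := fst \o fst.
pose pP : {rmorphism F * PF * rat -> PF} := snd \o fst.
have etaF r s (N : 'M_(r, s)) : map_mx pF (map_mx eta N) = map_mx iota N.
  by apply/matrixP=> k l; rewrite !mxE.
have etaP r s (N : 'M_(r, s)) : map_mx pP (map_mx eta N) = map_mx phi N.
  by apply/matrixP=> k l; rewrite !mxE.
have etaQ r s (N : 'M_(r, s)) : map_mx snd (map_mx eta N) = map_mx chi N.
  by apply/matrixP=> k l; rewrite !mxE.
have [Uq [NUq UqN Uq0]] := action_omit_inverse h_gt0 h_sum act_reach k0.
have [||||U [JU NU UN]] := Jinv _ (1%:M - omit _ k0 *m map_mx eta (action_mx act)) (cst _ _ Uq).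
- by apply/J1B/Jmul.
- exact: Jcst.
- by rewrite cstQ map_mxB map_mx1 map_mxM map_omit etaQ.
- by rewrite cstQ map_mxB map_mx1 map_mxM map_omit etaQ.
(* Fixedness of [y] is available in the [PF] and rational components only: in [F] the letters do not
   sum to 1. *)
pose y := cst _ _ L *m col k0 U.
have Jy : mx_in J y by apply: Jmul => // k l; rewrite mxE; exact: JU.
have yqE : map_mx snd y = L *m col k0 Uq.
  have UE : map_mx snd U = Uq.
    have NUs : (1%:M - omit _ k0 *m map_mx chi (action_mx act)) *m map_mx snd U = 1%:M.
      have := congr1 (map_mx snd) NU.
      by rewrite map_mxM map_mxB map_mxM map_omit etaQ !map_mx1.
    by rewrite -[LHS]mul1mx -UqN -mulmxA NUs mulmx1.
  by rewrite map_mxM cstQ map_col UE.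
have yq_gt0 k : 0 < (y k 0).2.
  have := action_fixed_gt0 hmu hcomplete htransitive h_gt0 h_sum actE Lmax NUq Uq0 k.
  by rewrite -yqE mxE.
have NUp : (1%:M - omit _ k0 *m map_mx phi (action_mx act)) *m map_mx pP U = 1%:M.
  have := congr1 (map_mx pP) NU.
  by rewrite map_mxM map_mxB map_mxM map_omit etaP !map_mx1.
have yp_fixed : Pmx *m map_mx pP y = map_mx pP y.
  by rewrite map_mxM etaP map_col; exact: (action_fixed actE psi1 NUp).
have yp_unit k : map_mx pP y k 0 \is a GRing.unit.
  have [|_ + _] := jointV chi_phi chi_iota (Jy k 0); first by rewrite gt_eqF.
  by move=> u; rewrite [map_mx _ _ _ _]mxE; exact: skPF.
have yq_fixed : map_mx chi (automaton_mx mu) *m (L *m col k0 Uq) = L *m col k0 Uq.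
  have := cstQ _ _ L; rewrite etaQ => LE.
  by have := action_fixed actE (bernoulli_sum h_sum) NUq; rewrite LE.
pose MT := map_mx eta (automaton_mx mu).
have JMT : mx_in J MT by exact: Jeta.
(* One matrix of triples holds three inverses: over [F] it expresses C_i and P_i, over [PF] it gives
   their values, over Q it is nonnegative. *)
have /choice[X XP] : forall i, exists X : 'M_n,
    [/\ mx_in J X, (1%:M - MT *m omit _ i) *m X = 1%:M, X *m (1%:M - MT *m omit _ i) = 1%:M
      & forall k l, 0 <= (X k l).2].
  move=> i; have [||Xq [NXq XqN Xq0]] := automaton_omit_inverse hmu htransitive h_gt0 (y := L
    *m col k0 Uq) i.
  - by move=> k; rewrite -yqE [map_mx _ _ _ _]mxE; exact: yq_gt0.
  - exact: yq_fixed.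
  have sN : map_mx snd (1%:M - MT *m omit _ i) = 1%:M - map_mx chi (automaton_mx mu) *m omit _
    i.
    by rewrite map_mxB map_mx1 map_mxM map_omit etaQ.
  have [||||X [JX NX XN]] := Jinv _ (1%:M - MT *m omit _ i) (cst _ _ Xq).
  - by apply/J1B/Jmul.
  - exact: Jcst.
  - by rewrite cstQ sN.
  - by rewrite cstQ sN.
  exists X; split=> // k l; suff <- : Xq k l = (X k l).2 by [].
  have NXs := congr1 (map_mx snd) NX; rewrite map_mxM map_mx1 sN in NXs.
  have -> : Xq = map_mx snd X by rewrite -[RHS]mul1mx -XqN -mulmxA NXs mulmx1.
  by rewrite mxE.
have JX i := (let: And4 h _ _ _ := XP i in h) : mx_in J (X i).
have NX i := (let: And4 _ h _ _ := XP i in h) : (1%:M - MT *m omit _ i) *m X i = 1%:M.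
have XN i := (let: And4 _ _ h _ := XP i in h) : X i *m (1%:M - MT *m omit _ i) = 1%:M.
have X0 i k l := (let: And4 _ _ _ h := XP i in h k l) : 0 <= (X i k l).2.
pose XF i := map_mx pF (X i); pose Xp i := map_mx pP (X i).
have NXF i : (1%:M - map_mx iota (automaton_mx mu) *m omit _ i) *m XF i = 1%:M.
  have := congr1 (map_mx pF) (NX i).
  by rewrite map_mxM map_mxB map_mxM map_omit etaF !map_mx1.
have XFN i : XF i *m (1%:M - map_mx iota (automaton_mx mu) *m omit _ i) = 1%:M.
  have := congr1 (map_mx pF) (XN i).
  by rewrite map_mxM map_mxB map_mxM map_omit etaF !map_mx1.
have NXp i : (1%:M - Pmx *m omit _ i) *m Xp i = 1%:M.
  have := congr1 (map_mx pP) (NX i).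
  by rewrite map_mxM map_mxB map_mxM map_omit etaP !map_mx1.
have XpN i : Xp i *m (1%:M - Pmx *m omit _ i) = 1%:M.
  have := congr1 (map_mx pP) (XN i).
  by rewrite map_mxM map_mxB map_mxM map_omit etaP !map_mx1.
have Xii i : X i i i = 1 by rewrite (omit_inverse_coli (XN i)) eqxx.
pose cT i := (X i *m MT) i i; pose dT i := (X i *m X i *m MT) i i; pose pT i := \sum_k X i i k.
have JcT i : J (cT i) by apply: Jmul.
have JdT i : J (dT i) by apply: (Jmul _ _ _ _ _ (Jmul _ _ _ _ _ (JX i) (JX i)) JMT).
have JpT i : J (pT i) by apply: (closed_sum J1 JN JD) => k _; exact: JX.
have CE i : C i = pF (cT i).
  rewrite /C (embed_return hmu hF (XFN i) (hcode i)) -etaF -map_mxM mxE //.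
have lCE i : lambda (C i) = pF (dT i).
  rewrite /C (embed_return hmu hF (XFN i) (hcode i)).
  by rewrite (derivation_return hF (XFN i) (NXF i)) // -etaF -!map_mxM mxE.
have PE i : P i = pF (pT i).
  rewrite /P (embed_path hmu hF (XFN i)) rmorph_sum.
  by apply: eq_bigr => k _; rewrite mxE.
have cpE i : pP (cT i) = (Xp i *m Pmx) i i by rewrite /Pmx -etaP -map_mxM mxE.
have dpE i : pP (dT i) = (Xp i *m Xp i *m Pmx) i i by rewrite /Pmx -etaP -!map_mxM mxE.
have ppE i : pP (pT i) = path_sum Xp i.
  by rewrite rmorph_sum; apply: eq_bigr => k _; rewrite mxE.
have c1 i : (Xp i *m Pmx) i i = 1 by exact: (omit_return1 (XpN i) yp_fixed (yp_unit i)).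
(* Over Q the sum is at least its diagonal term, which is 1. *)
have pT2 i : (pT i).2 != 0.
  rewrite gt_eqF // /pT raddf_sum (bigD1 i) //= Xii ltr_pwDl ?ltr01 //.
  by apply: sumr_ge0 => k _; exact: X0.
(* Over Q the value of lambda(C_i) is at least its term X_ii (X M)_ii = 1. *)
have dT2 i : (dT i).2 != 0.
  pose Mq := map_mx chi (automaton_mx mu); pose Xq := map_mx snd (X i).
  have XqN : Xq *m (1%:M - Mq *m omit _ i) = 1%:M.
    have := congr1 (map_mx snd) (XN i).
    by rewrite map_mxM map_mxB map_mxM map_omit etaQ !map_mx1.
  have Mq0 k l : 0 <= Mq k l by exact: (bernoulli_automaton_ge0 hmu h_gt0).
  have Xq0 k l : 0 <= Xq k l by rewrite mxE.
  have XMq0 k l : 0 <= (Xq *m Mq) k l by rewrite mxE; apply: sumr_ge0 => p _; exact: mulr_ge0.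
  have -> : (dT i).2 = (Xq *m (Xq *m Mq)) i i by rewrite mulmxA /Mq -etaQ -!map_mxM mxE.
  have yqi : (L *m col k0 Uq) i 0 \is a GRing.unit.
    by rewrite unitfE -yqE [map_mx _ _ _ _]mxE gt_eqF.
  rewrite gt_eqF // mxE (bigD1 i) //= (omit_return1 XqN yq_fixed yqi) mulr1.
  rewrite (omit_inverse_coli XqN) eqxx ltr_pwDl ?ltr01 //.
  by apply: sumr_ge0 => k _; exact: mulr_ge0.
have p_unit i : path_sum Xp i \is a GRing.unit.
  by have [_ + _] := jointV chi_phi chi_iota (JpT i) (pT2 i); rewrite -ppE; exact: skPF.
have d_neq0 i : (Xp i *m Xp i *m Pmx) i i != 0.
  by have [_ + _] := jointV chi_phi chi_iota (JdT i) (dT2 i); rewrite -dpE.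
have [i0 _] := vertex_exists hcomplete.
(* [mean] is a factor of the value of lambda(C_i) at any vertex, already known to be nonzero. *)
have mean_unit : mean Xp (map_mx pP y) \is a GRing.unit.
  apply: skPF; apply: contraNneq (d_neq0 i0) => mean0.
  by rewrite (return_time NXp XpN yp_fixed yp_unit p_unit) mean0 mulr0 mul0r.
have stat_M : stat Xp *m Pmx = stat Xp by exact: (stat_fixed NXp XpN yp_fixed yp_unit p_unit).
exists (fun i => pP (cT i)), (fun i => pP (pT i)), (stat Xp); split.
  move=> i; have [e [e1 e2 _]] := JcT i; have [e' [e1' e2' _]] := JpT i.
  have [n1 _ [e'' [e1'' e2'' _]]] := jointV chi_phi chi_iota (JpT i) (pT2 i).
  rewrite CE PE; split=> //; [by exists e | by exists e' |].
  by exists e''; rewrite e1'' e2'' mxE -ppE.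
split.
- by move=> i; rewrite cpE.
- pose JJ := limit_mx Xp (map_mx pP y).
  have idem : JJ *m JJ = JJ by exact: limit_idem.
  have PJ : Pmx *m JJ = JJ by exact: mul_limit.
  have JP : JJ *m Pmx = JJ by exact: (limit_mul NXp XpN yp_fixed yp_unit p_unit).
  have MX := mul_omit_inverse NXp XpN yp_fixed yp_unit p_unit mean_unit i0.
  have XM := omit_inverse_mul XpN yp_fixed yp_unit mean_unit i0.
  have [S [starS evS]] := star_eval_at1 skPF hPFt idem PJ JP
    (mul_deviation idem PJ MX) (deviation_mul idem JP XM).
  exists S, JJ; split=> // i; exists (pP (dT i)); split.
  + by rewrite lCE; have [e [e1 e2 _]] := JdT i; exists e.
  + by rewrite dpE.
  + by rewrite dpE (limit_diag NXp XpN yp_fixed yp_unit p_unit mean_unit).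
- exact: stat_M.
- apply: (stat_sum NXp XpN yp_fixed yp_unit p_unit).
  exact: leq_ltn_trans (leq0n i0) (ltn_ord i0).
- move=> l l' /maxL[k ->] /maxL[k' ->].
  have LE : map_mx (in_alg PF) L = map_mx phi (map_mx (in_alg _) L).
    by apply/matrixP=> r s; rewrite !mxE linearZ rmorph1.
  rewrite !map_col LE; set Lp := map_mx phi _.
  have stat_col r : (stat Xp *m col r Lp) 0 0 = (stat Xp *m Lp) 0 k0.
    by rewrite colE mulmxA -colE mxE; exact: (action_left_constant actE psi1 NUp stat_M).
  by apply/matrixP=> a b; rewrite !ord1 !stat_col.
Qed.
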